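(* There is no operation, definable in the syntax of DCwFs$+\mathsf{SET}$ (directed categories with families equipped with a directed univalent universe $\mathsf{SET}$), which for every neutral context $\Gamma\in\mathrm{NCon}$, every (not necessarily neutral) type $A\in\mathrm{Ty}(\Gamma)$, and all terms $t\in\mathrm{Tm}(\Gamma,A^-)$ and $t'\in\mathrm{Tm}(\Gamma,A)$, gives a function $$\mathsf{symm'}\colon\mathrm{Tm}(\Gamma,\mathrm{hom}(t,t'))\longrightarrow\mathrm{Tm}(\Gamma,\mathrm{hom}(-t',-t)).$$
   Context: All notions below are generalized algebraic theories (GATs): the listed operations and equations are the data of a model. The syntax is the initial model. **CwF.** A category with families (CwF) consists of: a category $\mathrm{Con}$ of contexts with hom-sets $\mathrm{Sub}(\Delta,\Gamma)$ of substitutions and a terminal object $\bullet$ (the empty context); a presheaf $\mathrm{Ty}$ on $\mathrm{Con}$ (action $A\mapsto A[\sigma]$); for $A\in\mathrm{Ty}(\Gamma)$ a set $\mathrm{Tm}(\Gamma,A)$ with a functorial action $\mathrm{Tm}(\Gamma,A)\to\mathrm{Tm}(\Delta,A[\sigma])$, $t\mapsto t[\sigma]$; and for $A\in\mathrm{Ty}(\Gamma)$ a context $\Gamma\triangleright^+A$ with bijections, natural in $\Delta$, between pairs $(\sigma\in\mathrm{Sub}(\Delta,\Gamma),\,t\in\mathrm{Tm}(\Delta,A[\sigma]))$ and $\mathrm{Sub}(\Delta,\Gamma\triangleright^+A)$. The substitution corresponding to $(\sigma,t)$ is $\langle\sigma,_+t\rangle$; the pair corresponding to the identity of $\Gamma\triangleright^+A$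 is $(\mathsf p_A,\mathsf v)$, with $\mathsf p_A\in\mathrm{Sub}(\Gamma\triangleright^+A,\Gamma)$ and $\mathsf v\in\mathrm{Tm}(\Gamma\triangleright^+A,A[\mathsf p_A])$. **PCwF.** A polarized CwF is a CwF with an endofunctor $(\cdot)^-$ on $\mathrm{Con}$ ($\Gamma\mapsto\Gamma^-$, $\sigma\in\mathrm{Sub}(\Delta,\Gamma)\mapsto\sigma^-\in\mathrm{Sub}(\Delta^-,\Gamma^-)$) which is an involution ($(\Gamma^-)^-=\Gamma$, $(\sigma^-)^-=\sigma$), and operations $A\mapsto A^-$ on each $\mathrm{Ty}(\Gamma)$ with $(A^-)^-=A$ and $(A[\sigma])^-=A^-[\sigma]$. For $A\in\mathrm{Ty}(\Gamma^-)$, negative context extension is defined by $\Gamma\triangleright^-A:=(\Gamma^-\triangleright^+A^-)^-$; it satisfies: pairs $(\sigma\in\mathrm{Sub}(\Delta,\Gamma),\,t\in\mathrm{Tm}(\Delta^-,A[\sigma^-]^-))$ correspond naturally and bijectively to $\mathrm{Sub}(\Delta,\Gamma\triangleright^-A)$, with notation $\langle\sigma,_-t\rangle$ and projection $\mathsf p_{-,A}\in\mathrm{Sub}(\Gamma\triangleright^-A,\Gamma)$. **NPCwF.** A neutral-polarized CwF is a PCwF with a sub-PCwF of neutral contexts and types, i.e. predicates $\mathrm{NCon}\subseteq\mathrm{Con}$ and $\mathrm{NTy}(\Gamma)\subseteq\mathrm{Ty}(\Gamma)$ such that $\bullet\in\mathrm{NCon}$; $\Gamma\in\mathrm{NCon}$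 implies $\Gamma^-\in\mathrm{NCon}$; $\mathrm{NTy}$ is closed under substitution and $(\cdot)^-$; and $\Gamma\triangleright^+A\in\mathrm{NCon}$ whenever $\Gamma\in\mathrm{NCon}$, $A\in\mathrm{NTy}(\Gamma)$; together with: - for each $\Gamma\in\mathrm{NCon}$, an isomorphism $e=e_\Gamma\in\mathrm{Sub}(\Gamma,\Gamma^-)$, with inverse $e^-$; - for each $\Gamma\in\mathrm{NCon}$ and each (not necessarily neutral) $A\in\mathrm{Ty}(\Gamma)$, term negation $\mathrm{Tm}(\Gamma,A)\to\mathrm{Tm}(\Gamma,A^-)$, $t\mapsto -t$, with $-(-t)=t$ and $(-t)[\sigma]=-(t[\sigma])$ for substitutions $\sigma$ between neutral contexts (since $(A^-)^-=A$, this also turns terms of $A^-$ into terms of $A$); - for each $\Gamma\in\mathrm{NCon}$ and each (not necessarily neutral) $A\in\mathrm{Ty}(\Gamma^-)$, an isomorphism $e\triangleright A\in\mathrm{Sub}(\Gamma\triangleright^+A[e],\Gamma\triangleright^-A)$ with $\mathsf p_{-,A}\circ(e\triangleright A)=\mathsf p_{A[e]}$ and $\langle\mathrm{id},_-t\rangle=(e\triangleright A)\circ\langle\mathrm{id},_+-(t[e])\rangle$ for all $t\in\mathrm{Tm}(\Gamma^-,A^-)$. **DCwF.** A directed CwF is an NPCwF with: - hom-types: for any context $\Gamma$, $A\in\mathrm{Ty}(\Gamma)$, $t\in\mathrm{Tm}(\Gamma,A^-)$, $t'\in\mathrm{Tm}(\Gamma,A)$, a type $\mathrm{hom}(t,t')\in\mathrm{Ty}(\Gamma)$,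 stable under substitution; - for $\Gamma\in\mathrm{NCon}$, $A\in\mathrm{Ty}(\Gamma)$, $t\in\mathrm{Tm}(\Gamma,A^-)$, a term $\mathsf{refl}_t\in\mathrm{Tm}(\Gamma,\mathrm{hom}(t,-t))$, stable under substitution between neutral contexts; - directed J: for $\Gamma\in\mathrm{NCon}$, $A\in\mathrm{Ty}(\Gamma)$, $t\in\mathrm{Tm}(\Gamma,A^-)$, $M\in\mathrm{Ty}(\Gamma\triangleright^+A\triangleright^+\mathrm{hom}(t[\mathsf p_A],\mathsf v))$ and $m\in\mathrm{Tm}(\Gamma,M[-t,\mathsf{refl}_t])$, a term $\mathsf J_{t,M}\,m\in\mathrm{Tm}(\Gamma\triangleright^+A\triangleright^+\mathrm{hom}(t[\mathsf p_A],\mathsf v),M)$ with $(\mathsf J_{t,M}\,m)[-t,\mathsf{refl}_t]=m$, stable under substitution between neutral contexts. Here $M[t',p]$ denotes substitution along $\langle\langle\mathrm{id},_+t'\rangle,_+p\rangle$, and likewise for terms. **Polarized $\Pi$-types.** For $A\in\mathrm{Ty}(\Gamma^-)$ and $B\in\mathrm{Ty}(\Gamma\triangleright^-A)$, a type $\Pi(A,B)\in\mathrm{Ty}(\Gamma)$, stable under substitution, with a bijection $\mathsf{app}\colon\mathrm{Tm}(\Gamma,\Pi(A,B))\cong\mathrm{Tm}(\Gamma\triangleright^-A,B)$, natural in $\Gamma$, with inverse $\mathsf{lam}$. For $B\in\mathrm{Ty}(\Gamma)$ write $A\to B:=\Pi(A,B[\mathsf p_{-,A}])$. **DCwF$+\mathsf{SET}$.**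 A DCwF with polarized $\Pi$-types, a closed type $\mathsf{SET}\in\mathrm{Ty}(\bullet)$, and a type family $\mathrm{El}\in\mathrm{Ty}(\bullet\triangleright^+\mathsf{SET})$; for $Y\in\mathrm{Tm}(\bullet,\mathsf{SET})$ write $\mathrm{El}(Y):=\mathrm{El}[\langle\mathrm{id},_+Y\rangle]\in\mathrm{Ty}(\bullet)$, and for $X\in\mathrm{Tm}(\bullet,\mathsf{SET}^-)$ write $\mathrm{El}(X)$ for $\mathrm{El}(-X)$. It is required to be directed univalent: for all $X\in\mathrm{Tm}(\bullet,\mathsf{SET}^-)$, $Y\in\mathrm{Tm}(\bullet,\mathsf{SET})$, the map $$\text{Hom-to-func}\colon\mathrm{Tm}(\bullet,\mathrm{hom}(X,Y))\to\mathrm{Tm}(\bullet,\mathrm{El}(X)\to\mathrm{El}(Y))$$ is a bijection. Here the domain type $\mathrm{El}(X)$ is transported to $\mathrm{Ty}(\bullet^-)$ along the unique substitution $\bullet^-\to\bullet$, and Hom-to-func is defined by directed J (with motive $M(x,y)=(\mathrm{El}(X)\to\mathrm{El}(x))$ over $x:\mathsf{SET}$, $y:\mathrm{hom}(X,x)$), sending $\mathsf{refl}_X$ to the identity function, i.e. $\mathsf{lam}(\mathsf v[(e\triangleright A)^{-1}])$ for $A=\mathrm{El}(X)\in\mathrm{Ty}(\bullet^-)$. The intended standard example is the category model: contexts are categories, substitutions are functors, types over $\Gamma$ are functors $\Gamma\to\mathrm{Cat}$, terms of $A$ are functorial sections (an object $t(\gamma)$ of $A(\gamma)$ for each $\gamma$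 and a morphism $A(\gamma_{01})(t(\gamma_0))\to t(\gamma_1)$ for each $\gamma_{01}\colon\gamma_0\to\gamma_1$), $(\cdot)^-$ is the opposite category (applied to contexts, resp. fibrewise to types), neutral contexts/types are groupoids/families of groupoids, $\mathrm{hom}(t,t')(\gamma)$ is the discrete category on the set of morphisms $t(\gamma)\to t'(\gamma)$ in $A(\gamma)$, $\mathsf{SET}$ is the category of sets, and $\mathrm{El}$ sends a set to its discrete category. **Definable operation.** An operation of a given type is definable in the syntax of a GAT if it is a derived operation, i.e. given by an expression built from the operations of the theory in generic arguments (here generic $\Gamma,A,t,t'$ and a generic element of $\mathrm{Tm}(\Gamma,\mathrm{hom}(t,t'))$), well-typed by the equations of the theory. Such an operation is interpreted in every model of the theory (of any size), as a family of functions of the given type preserved by all homomorphisms of models. *)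

(* Defs.v *)
From mathcomp Require Import all_boot.

Set Implicit Arguments.
Unset Strict Implicit.
Unset Printing Implicit Defensive.

(* Generalized algebraic theories, in the style of Cartmell.  A context is a
   telescope of sorts in which [Var i] stands for the [i]-th entry (counting
   from the left); operations take all their arguments explicitly. *)

Inductive term (O : Type) : Type :=
  | Var of nat
  | Op of O & seq (term O).
Arguments Var {O}.

Record sort_expr (S O : Type) := Sort { sort_head : S; sort_args : seq (term O) }.

Record equation (S O : Type) :=
  Equation { eq_lhs : term O; eq_rhs : term O; eq_sort : sort_expr S O }.

Fixpoint subst (O : Type) (θ : seq (term O)) (t : term O) : term O :=
  match t with
  | Var i => nth (Var i) θ i
  | Op f ts => Op f (map (subst θ) ts)
  end.

Definition sort_subst (S O : Type) (θ : seq (term O)) (s : sort_expr S O) :=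
  Sort (sort_head s) (map (subst θ) (sort_args s)).

(* A declaration [∀ x1 ∈ S1, .., ∀ xn ∈ Sn, r].  The named variables are only
   a device for writing declarations: [tele_ctx] and [tele_body] instantiate
   them with [Var 0], [Var 1], etc. *)
Inductive tele (S O X : Type) : Type :=
  | Body of X
  | Bind of sort_expr S O & (term O -> tele S O X).

Fixpoint tele_ctx_from (S O X : Type) (n : nat) (d : tele S O X) :
    seq (sort_expr S O) :=
  match d with
  | Body _ => [::]
  | Bind s k => s :: tele_ctx_from n.+1 (k (Var n))
  end.

Fixpoint tele_body_from (S O X : Type) (n : nat) (d : tele S O X) : X :=
  match d with
  | Body x => x
  | Bind _ k => tele_body_from n.+1 (k (Var n))
  end.

Definition tele_ctx (S O X : Type) (d : tele S O X) := tele_ctx_from 0 d.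
Definition tele_body (S O X : Type) (d : tele S O X) := tele_body_from 0 d.

Record gat := Gat {
  sort_sym : Type;
  op_sym : Type;
  ax_sym : Type;
  sort_decl : sort_sym -> tele sort_sym op_sym unit;
  op_decl : op_sym -> tele sort_sym op_sym (sort_expr sort_sym op_sym);
  ax_decl : ax_sym -> tele sort_sym op_sym (equation sort_sym op_sym) }.

Inductive judgment (S O : Type) : Type :=
  | HasSort of term O & sort_expr S O
  | EqSort of sort_expr S O & sort_expr S O
  | EqTerm of term O & term O & sort_expr S O.
Arguments HasSort {S O}.
Arguments EqSort {S O}.
Arguments EqTerm {S O}.

(* In the three rules for symbols, the last two premises say that [θ] (resp.
   the pair [θ], [θ']) is an instance (resp. a pair of equal instances) of the
   context in which the symbol is declared.  Since [s] is the [i]-th entry of a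
   telescope, [sort_subst θ s] only involves the entries of [θ] before the
   [i]-th. *)
Inductive derivable (T : gat) (Γ : seq (sort_expr (sort_sym T) (op_sym T))) :
    judgment (sort_sym T) (op_sym T) -> Prop :=
  | d_var i s :
      onth Γ i = Some s ->
      derivable Γ (HasSort (Var i) s)
  | d_op f θ :
      size θ = size (tele_ctx (op_decl f)) ->
      (forall i t s, onth θ i = Some t -> onth (tele_ctx (op_decl f)) i = Some s ->
         derivable Γ (HasSort t (sort_subst θ s))) ->
      derivable Γ (HasSort (Op f θ) (sort_subst θ (tele_body (op_decl f))))
  | d_conv t s s' :
      derivable Γ (HasSort t s) -> derivable Γ (EqSort s s') ->
      derivable Γ (HasSort t s')
  | d_sort_congr S θ θ' :
      size θ = size (tele_ctx (sort_decl S)) ->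
      size θ' = size (tele_ctx (sort_decl S)) ->
      (forall i t t' s, onth θ i = Some t -> onth θ' i = Some t' ->
         onth (tele_ctx (sort_decl S)) i = Some s ->
         derivable Γ (EqTerm t t' (sort_subst θ s))) ->
      derivable Γ (EqSort (Sort S θ) (Sort S θ'))
  | d_sort_sym s s' :
      derivable Γ (EqSort s s') -> derivable Γ (EqSort s' s)
  | d_sort_trans s s' s'' :
      derivable Γ (EqSort s s') -> derivable Γ (EqSort s' s'') ->
      derivable Γ (EqSort s s'')
  | d_refl t s :
      derivable Γ (HasSort t s) -> derivable Γ (EqTerm t t s)
  | d_sym t t' s :
      derivable Γ (EqTerm t t' s) -> derivable Γ (EqTerm t' t s)
  | d_trans t t' t'' s :
      derivable Γ (EqTerm t t' s) -> derivable Γ (EqTerm t' t'' s) ->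
      derivable Γ (EqTerm t t'' s)
  | d_eq_conv t t' s s' :
      derivable Γ (EqTerm t t' s) -> derivable Γ (EqSort s s') ->
      derivable Γ (EqTerm t t' s')
  | d_op_congr f θ θ' :
      size θ = size (tele_ctx (op_decl f)) ->
      size θ' = size (tele_ctx (op_decl f)) ->
      (forall i t t' s, onth θ i = Some t -> onth θ' i = Some t' ->
         onth (tele_ctx (op_decl f)) i = Some s ->
         derivable Γ (EqTerm t t' (sort_subst θ s))) ->
      derivable Γ (EqTerm (Op f θ) (Op f θ')
                          (sort_subst θ (tele_body (op_decl f))))
  | d_axiom a θ :
      size θ = size (tele_ctx (ax_decl a)) ->
      (forall i t s, onth θ i = Some t -> onth (tele_ctx (ax_decl a)) i = Some s ->
         derivable Γ (HasSort t (sort_subst θ s))) ->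
      derivable Γ (EqTerm (subst θ (eq_lhs (tele_body (ax_decl a))))
                          (subst θ (eq_rhs (tele_body (ax_decl a))))
                          (sort_subst θ (eq_sort (tele_body (ax_decl a))))).

(* An operation of type [d] is definable in the syntax of [T] if some
   expression in the generic arguments bound by [d] has the result sort. *)
Definition definable (T : gat)
    (d : tele (sort_sym T) (op_sym T) (sort_expr (sort_sym T) (op_sym T))) : Prop :=
  exists t : term (op_sym T), derivable (tele_ctx d) (HasSort t (tele_body d)).

(* Directed categories with families with a directed univalent universe.  The
   predicates of neutral contexts and neutral types are sorts with at most one
   element (see [A_NCon_irr] and [A_NTy_irr]). *)

Inductive dsort := S_Con | S_Sub | S_Ty | S_Tm | S_NCon | S_NTy.

Inductive dop :=
  | O_id | O_comp | O_emp | O_eps | O_tyS | O_tmS | O_ext | O_pair | O_p | O_v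
  | O_cneg | O_sneg | O_tneg
  | O_nemp | O_ncneg | O_next | O_ntyS | O_ntneg
  | O_e | O_neg | O_eext | O_eext_inv
  | O_hom | O_refl | O_J
  | O_Pi | O_app | O_lam
  | O_SET | O_El | O_func_to_hom.

Notation dterm := (term dop).
Notation dtele := (tele dsort dop).

Notation "∀ x ∈ S , d" := (Bind S (fun x => d))
  (at level 200, x name, S at level 99, d at level 200, right associativity,
   format "'[' ∀  x  ∈  S ,  '/' d ']'").
Notation "⊢ s" := (@Body dsort dop _ s) (at level 200, s at level 99).
Notation "l ≡ r ∈ S" := (@Equation dsort dop l r S)
  (at level 90, r at level 69, S at level 69, no associativity).

Definition Con : sort_expr dsort dop := Sort S_Con [::].
Definition Sub (Δ Γ : dterm) : sort_expr dsort dop := Sort S_Sub [:: Δ; Γ].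
Definition Ty (Γ : dterm) : sort_expr dsort dop := Sort S_Ty [:: Γ].
Definition Tm (Γ A : dterm) : sort_expr dsort dop := Sort S_Tm [:: Γ; A].
Definition NCon (Γ : dterm) : sort_expr dsort dop := Sort S_NCon [:: Γ].
Definition NTy (Γ A : dterm) : sort_expr dsort dop := Sort S_NTy [:: Γ; A].

Definition dsort_decl (s : dsort) : dtele unit :=
  match s with
  | S_Con => ⊢ tt
  | S_Sub => ∀ Δ ∈ Con, ∀ Γ ∈ Con, ⊢ tt
  | S_Ty => ∀ Γ ∈ Con, ⊢ tt
  | S_Tm => ∀ Γ ∈ Con, ∀ A ∈ Ty Γ, ⊢ tt
  | S_NCon => ∀ Γ ∈ Con, ⊢ tt
  | S_NTy => ∀ Γ ∈ Con, ∀ A ∈ Ty Γ, ⊢ tt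
  end.

Definition idS (Γ : dterm) : dterm := Op O_id [:: Γ].
(* [comp Θ Δ Γ σ τ] is σ ∘ τ for σ ∈ Sub Δ Γ and τ ∈ Sub Θ Δ. *)
Definition comp (Θ Δ Γ σ τ : dterm) : dterm := Op O_comp [:: Θ; Δ; Γ; σ; τ].
Definition emp : dterm := Op O_emp [::].
Definition eps (Γ : dterm) : dterm := Op O_eps [:: Γ].
(* A[σ] and t[σ] for σ ∈ Sub Δ Γ. *)
Definition tyS (Δ Γ A σ : dterm) : dterm := Op O_tyS [:: Δ; Γ; A; σ].
Definition tmS (Δ Γ A t σ : dterm) : dterm := Op O_tmS [:: Δ; Γ; A; t; σ].
Definition ext (Γ A : dterm) : dterm := Op O_ext [:: Γ; A].
Definition pairS (Δ Γ A σ t : dterm) : dterm := Op O_pair [:: Δ; Γ; A; σ; t].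
Definition p (Γ A : dterm) : dterm := Op O_p [:: Γ; A].
Definition v (Γ A : dterm) : dterm := Op O_v [:: Γ; A].

Definition cneg (Γ : dterm) : dterm := Op O_cneg [:: Γ].
Definition sneg (Δ Γ σ : dterm) : dterm := Op O_sneg [:: Δ; Γ; σ].
Definition tneg (Γ A : dterm) : dterm := Op O_tneg [:: Γ; A].

Definition nemp : dterm := Op O_nemp [::].
Definition ncneg (Γ n : dterm) : dterm := Op O_ncneg [:: Γ; n].
Definition next (Γ n A a : dterm) : dterm := Op O_next [:: Γ; n; A; a].
Definition ntyS (Δ Γ A a σ : dterm) : dterm := Op O_ntyS [:: Δ; Γ; A; a; σ].
Definition ntneg (Γ A a : dterm) : dterm := Op O_ntneg [:: Γ; A; a].

Definition e (Γ n : dterm) : dterm := Op O_e [:: Γ; n].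
(* Term negation -t; note that [neg Γ n (tneg Γ A) t] has sort
   [Tm Γ (tneg Γ (tneg Γ A))], which equals [Tm Γ A]. *)
Definition neg (Γ n A t : dterm) : dterm := Op O_neg [:: Γ; n; A; t].
Definition eext (Γ n A : dterm) : dterm := Op O_eext [:: Γ; n; A].
Definition eext_inv (Γ n A : dterm) : dterm := Op O_eext_inv [:: Γ; n; A].

Definition hom (Γ A t t' : dterm) : dterm := Op O_hom [:: Γ; A; t; t'].
Definition reflT (Γ n A t : dterm) : dterm := Op O_refl [:: Γ; n; A; t].
Definition J (Γ n A t M m : dterm) : dterm := Op O_J [:: Γ; n; A; t; M; m].

Definition Pi (Γ A B : dterm) : dterm := Op O_Pi [:: Γ; A; B].
Definition app (Γ A B f : dterm) : dterm := Op O_app [:: Γ; A; B; f].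
Definition lam (Γ A B b : dterm) : dterm := Op O_lam [:: Γ; A; B; b].

Definition SET : dterm := Op O_SET [::].
Definition El : dterm := Op O_El [::].
Definition func_to_hom (X Y f : dterm) : dterm := Op O_func_to_hom [:: X; Y; f].

(* ⟨id, t⟩ ∈ Sub Γ (Γ ▷⁺ A). *)
Definition sub1 (Γ A t : dterm) : dterm := pairS Γ Γ A (idS Γ) t.

(* ⟨σ ∘ p, v⟩ ∈ Sub (Δ ▷⁺ A[σ]) (Γ ▷⁺ A). *)
Definition lift (Δ Γ A σ : dterm) : dterm :=
  let Aσ := tyS Δ Γ A σ in
  pairS (ext Δ Aσ) Γ A (comp (ext Δ Aσ) Δ Γ σ (p Δ Aσ)) (v Δ Aσ).

(* Negative context extension Γ ▷⁻ A, for A ∈ Ty Γ⁻. *)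
Definition extN (Γ A : dterm) : dterm :=
  cneg (ext (cneg Γ) (tneg (cneg Γ) A)).

(* The projection in Sub (Γ ▷⁻ A) Γ. *)
Definition pN (Γ A : dterm) : dterm :=
  sneg (ext (cneg Γ) (tneg (cneg Γ) A)) (cneg Γ) (p (cneg Γ) (tneg (cneg Γ) A)).

(* ⟨σ ,₋ t⟩ ∈ Sub Δ (Γ ▷⁻ A), for σ ∈ Sub Δ Γ and t ∈ Tm Δ⁻ A[σ⁻]⁻. *)
Definition pairN (Δ Γ A σ t : dterm) : dterm :=
  sneg (cneg Δ) (ext (cneg Γ) (tneg (cneg Γ) A))
    (pairS (cneg Δ) (cneg Γ) (tneg (cneg Γ) A) (sneg Δ Γ σ) t).

(* The substitution Sub (Δ ▷⁻ A[σ⁻]) (Γ ▷⁻ A) induced by σ ∈ Sub Δ Γ. *)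
Definition liftN (Δ Γ A σ : dterm) : dterm :=
  let A' := tneg (cneg Γ) A in
  sneg (ext (cneg Δ) (tyS (cneg Δ) (cneg Γ) A' (sneg Δ Γ σ))) (ext (cneg Γ) A')
    (lift (cneg Δ) (cneg Γ) A' (sneg Δ Γ σ)).

(* The type hom(t[p], v) over Γ ▷⁺ A, for t ∈ Tm Γ A⁻. *)
Definition hom_ty (Γ A t : dterm) : dterm :=
  hom (ext Γ A) (tyS (ext Γ A) Γ A (p Γ A))
    (tmS (ext Γ A) Γ (tneg Γ A) t (p Γ A)) (v Γ A).

Definition hom_ctx (Γ A t : dterm) : dterm := ext (ext Γ A) (hom_ty Γ A t).

(* ⟨⟨id, t'⟩, q⟩ ∈ Sub Γ (hom_ctx Γ A t), for q ∈ Tm Γ hom(t, t'). *)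
Definition hom_sub (Γ A t t' q : dterm) : dterm :=
  pairS Γ (ext Γ A) (hom_ty Γ A t) (sub1 Γ A t') q.

(* ⟨⟨id, -t⟩, refl t⟩. *)
Definition refl_sub (Γ n A t : dterm) : dterm :=
  hom_sub Γ A t (neg Γ n (tneg Γ A) t) (reflT Γ n A t).

(* The substitution from [hom_ctx Δ A[σ] t[σ]] to [hom_ctx Γ A t]. *)
Definition hom_lift (Δ Γ A t σ : dterm) : dterm :=
  lift (ext Δ (tyS Δ Γ A σ)) (ext Γ A) (hom_ty Γ A t) (lift Δ Γ A σ).

(* A → B, for A ∈ Ty Γ⁻ and B ∈ Ty Γ. *)
Definition arr (Γ A B : dterm) : dterm :=
  Pi Γ A (tyS (extN Γ A) Γ B (pN Γ A)).

(* El(Y) for Y ∈ Tm ∙ SET, and El(X) for X ∈ Tm ∙ SET⁻. *)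
Definition El_pos (Y : dterm) : dterm := tyS emp (ext emp SET) El (sub1 emp SET Y).
Definition El_neg (X : dterm) : dterm := El_pos (neg emp nemp (tneg emp SET) X).

(* El(X) as a type over ∙⁻. *)
Definition El_dom (X : dterm) : dterm :=
  tyS (cneg emp) emp (El_neg X) (eps (cneg emp)).

(* The motive El(X) → El(x) over x : SET, y : hom(X, x). *)
Definition hom_to_func_motive (X : dterm) : dterm :=
  let Θ := hom_ctx emp SET X in
  let q := p (ext emp SET) (hom_ty emp SET X) in
  arr Θ
    (tyS (cneg Θ) (cneg emp) (El_dom X)
       (sneg Θ emp (comp Θ (ext emp SET) emp (p emp SET) q)))
    (tyS Θ (ext emp SET) El q).

(* lam(v[(e ▷ A)⁻¹]) for A ∈ Ty Γ⁻, of type A → A[e]. *)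
Definition id_func (Γ n A : dterm) : dterm :=
  let Ae := tyS Γ (cneg Γ) A (e Γ n) in
  lam Γ A (tyS (extN Γ A) Γ Ae (pN Γ A))
    (tmS (extN Γ A) (ext Γ Ae) (tyS (ext Γ Ae) Γ Ae (p Γ Ae)) (v Γ Ae)
       (eext_inv Γ n A)).

Definition hom_to_func (X Y h : dterm) : dterm :=
  tmS emp (hom_ctx emp SET X) (hom_to_func_motive X)
    (J emp nemp SET X (hom_to_func_motive X) (id_func emp nemp (El_dom X)))
    (hom_sub emp SET X Y h).

Definition dop_decl (o : dop) : dtele (sort_expr dsort dop) :=
  match o with
  | O_id => ∀ Γ ∈ Con, ⊢ Sub Γ Γ
  | O_comp =>
      ∀ Θ ∈ Con, ∀ Δ ∈ Con, ∀ Γ ∈ Con, ∀ σ ∈ Sub Δ Γ, ∀ τ ∈ Sub Θ Δ, ⊢ Sub Θ Γ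
  | O_emp => ⊢ Con
  | O_eps => ∀ Γ ∈ Con, ⊢ Sub Γ emp
  | O_tyS => ∀ Δ ∈ Con, ∀ Γ ∈ Con, ∀ A ∈ Ty Γ, ∀ σ ∈ Sub Δ Γ, ⊢ Ty Δ
  | O_tmS =>
      ∀ Δ ∈ Con, ∀ Γ ∈ Con, ∀ A ∈ Ty Γ, ∀ t ∈ Tm Γ A, ∀ σ ∈ Sub Δ Γ,
      ⊢ Tm Δ (tyS Δ Γ A σ)
  | O_ext => ∀ Γ ∈ Con, ∀ A ∈ Ty Γ, ⊢ Con
  | O_pair =>
      ∀ Δ ∈ Con, ∀ Γ ∈ Con, ∀ A ∈ Ty Γ, ∀ σ ∈ Sub Δ Γ, ∀ t ∈ Tm Δ (tyS Δ Γ A σ),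
      ⊢ Sub Δ (ext Γ A)
  | O_p => ∀ Γ ∈ Con, ∀ A ∈ Ty Γ, ⊢ Sub (ext Γ A) Γ
  | O_v => ∀ Γ ∈ Con, ∀ A ∈ Ty Γ, ⊢ Tm (ext Γ A) (tyS (ext Γ A) Γ A (p Γ A))
  | O_cneg => ∀ Γ ∈ Con, ⊢ Con
  | O_sneg => ∀ Δ ∈ Con, ∀ Γ ∈ Con, ∀ σ ∈ Sub Δ Γ, ⊢ Sub (cneg Δ) (cneg Γ)
  | O_tneg => ∀ Γ ∈ Con, ∀ A ∈ Ty Γ, ⊢ Ty Γ
  | O_nemp => ⊢ NCon emp
  | O_ncneg => ∀ Γ ∈ Con, ∀ n ∈ NCon Γ, ⊢ NCon (cneg Γ)
  | O_next =>
      ∀ Γ ∈ Con, ∀ n ∈ NCon Γ, ∀ A ∈ Ty Γ, ∀ a ∈ NTy Γ A, ⊢ NCon (ext Γ A)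
  | O_ntyS =>
      ∀ Δ ∈ Con, ∀ Γ ∈ Con, ∀ A ∈ Ty Γ, ∀ a ∈ NTy Γ A, ∀ σ ∈ Sub Δ Γ,
      ⊢ NTy Δ (tyS Δ Γ A σ)
  | O_ntneg => ∀ Γ ∈ Con, ∀ A ∈ Ty Γ, ∀ a ∈ NTy Γ A, ⊢ NTy Γ (tneg Γ A)
  | O_e => ∀ Γ ∈ Con, ∀ n ∈ NCon Γ, ⊢ Sub Γ (cneg Γ)
  | O_neg =>
      ∀ Γ ∈ Con, ∀ n ∈ NCon Γ, ∀ A ∈ Ty Γ, ∀ t ∈ Tm Γ A, ⊢ Tm Γ (tneg Γ A)
  | O_eext =>
      ∀ Γ ∈ Con, ∀ n ∈ NCon Γ, ∀ A ∈ Ty (cneg Γ),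
      ⊢ Sub (ext Γ (tyS Γ (cneg Γ) A (e Γ n))) (extN Γ A)
  | O_eext_inv =>
      ∀ Γ ∈ Con, ∀ n ∈ NCon Γ, ∀ A ∈ Ty (cneg Γ),
      ⊢ Sub (extN Γ A) (ext Γ (tyS Γ (cneg Γ) A (e Γ n)))
  | O_hom =>
      ∀ Γ ∈ Con, ∀ A ∈ Ty Γ, ∀ t ∈ Tm Γ (tneg Γ A), ∀ t' ∈ Tm Γ A, ⊢ Ty Γ
  | O_refl =>
      ∀ Γ ∈ Con, ∀ n ∈ NCon Γ, ∀ A ∈ Ty Γ, ∀ t ∈ Tm Γ (tneg Γ A),
      ⊢ Tm Γ (hom Γ A t (neg Γ n (tneg Γ A) t))
  | O_J =>
      ∀ Γ ∈ Con, ∀ n ∈ NCon Γ, ∀ A ∈ Ty Γ, ∀ t ∈ Tm Γ (tneg Γ A),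
      ∀ M ∈ Ty (hom_ctx Γ A t),
      ∀ m ∈ Tm Γ (tyS Γ (hom_ctx Γ A t) M (refl_sub Γ n A t)),
      ⊢ Tm (hom_ctx Γ A t) M
  | O_Pi => ∀ Γ ∈ Con, ∀ A ∈ Ty (cneg Γ), ∀ B ∈ Ty (extN Γ A), ⊢ Ty Γ
  | O_app =>
      ∀ Γ ∈ Con, ∀ A ∈ Ty (cneg Γ), ∀ B ∈ Ty (extN Γ A), ∀ f ∈ Tm Γ (Pi Γ A B),
      ⊢ Tm (extN Γ A) B
  | O_lam =>
      ∀ Γ ∈ Con, ∀ A ∈ Ty (cneg Γ), ∀ B ∈ Ty (extN Γ A), ∀ b ∈ Tm (extN Γ A) B,
      ⊢ Tm Γ (Pi Γ A B)
  | O_SET => ⊢ Ty emp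
  | O_El => ⊢ Ty (ext emp SET)
  | O_func_to_hom =>
      ∀ X ∈ Tm emp (tneg emp SET), ∀ Y ∈ Tm emp SET,
      ∀ f ∈ Tm emp (arr emp (El_dom X) (El_pos Y)),
      ⊢ Tm emp (hom emp SET X Y)
  end.

Inductive dax :=
  | A_idl | A_idr | A_assoc | A_eps
  | A_ty_id | A_ty_comp | A_tm_id | A_tm_comp
  | A_pair_p | A_pair_v | A_pair_comp | A_pair_eta
  | A_cneg_invol | A_sneg_id | A_sneg_comp | A_sneg_invol
  | A_tneg_invol | A_tneg_sub
  | A_NCon_irr | A_NTy_irr
  | A_e_inv_l | A_e_inv_r
  | A_neg_invol | A_neg_sub
  | A_eext_inv_l | A_eext_inv_r | A_eext_p | A_eext_pair
  | A_hom_sub | A_refl_sub | A_J_beta | A_J_sub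
  | A_Pi_sub | A_app_sub | A_beta | A_eta
  | A_univ_l | A_univ_r.

Definition dax_decl (a : dax) : dtele (equation dsort dop) :=
  match a with
  | A_idl =>
      ∀ Δ ∈ Con, ∀ Γ ∈ Con, ∀ σ ∈ Sub Δ Γ,
      ⊢ comp Δ Γ Γ (idS Γ) σ ≡ σ ∈ Sub Δ Γ
  | A_idr =>
      ∀ Δ ∈ Con, ∀ Γ ∈ Con, ∀ σ ∈ Sub Δ Γ,
      ⊢ comp Δ Δ Γ σ (idS Δ) ≡ σ ∈ Sub Δ Γ
  | A_assoc =>
      ∀ Ξ ∈ Con, ∀ Θ ∈ Con, ∀ Δ ∈ Con, ∀ Γ ∈ Con,
      ∀ σ ∈ Sub Δ Γ, ∀ τ ∈ Sub Θ Δ, ∀ ρ ∈ Sub Ξ Θ,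
      ⊢ comp Ξ Θ Γ (comp Θ Δ Γ σ τ) ρ ≡ comp Ξ Δ Γ σ (comp Ξ Θ Δ τ ρ) ∈ Sub Ξ Γ
  | A_eps => ∀ Γ ∈ Con, ∀ σ ∈ Sub Γ emp, ⊢ σ ≡ eps Γ ∈ Sub Γ emp
  | A_ty_id => ∀ Γ ∈ Con, ∀ A ∈ Ty Γ, ⊢ tyS Γ Γ A (idS Γ) ≡ A ∈ Ty Γ
  | A_ty_comp =>
      ∀ Θ ∈ Con, ∀ Δ ∈ Con, ∀ Γ ∈ Con, ∀ A ∈ Ty Γ, ∀ σ ∈ Sub Δ Γ, ∀ τ ∈ Sub Θ Δ,
      ⊢ tyS Θ Γ A (comp Θ Δ Γ σ τ) ≡ tyS Θ Δ (tyS Δ Γ A σ) τ ∈ Ty Θ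
  | A_tm_id =>
      ∀ Γ ∈ Con, ∀ A ∈ Ty Γ, ∀ t ∈ Tm Γ A, ⊢ tmS Γ Γ A t (idS Γ) ≡ t ∈ Tm Γ A
  | A_tm_comp =>
      ∀ Θ ∈ Con, ∀ Δ ∈ Con, ∀ Γ ∈ Con, ∀ A ∈ Ty Γ, ∀ t ∈ Tm Γ A,
      ∀ σ ∈ Sub Δ Γ, ∀ τ ∈ Sub Θ Δ,
      ⊢ tmS Θ Γ A t (comp Θ Δ Γ σ τ) ≡ tmS Θ Δ (tyS Δ Γ A σ) (tmS Δ Γ A t σ) τ
        ∈ Tm Θ (tyS Θ Γ A (comp Θ Δ Γ σ τ))
  | A_pair_p =>
      ∀ Δ ∈ Con, ∀ Γ ∈ Con, ∀ A ∈ Ty Γ, ∀ σ ∈ Sub Δ Γ, ∀ t ∈ Tm Δ (tyS Δ Γ A σ),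
      ⊢ comp Δ (ext Γ A) Γ (p Γ A) (pairS Δ Γ A σ t) ≡ σ ∈ Sub Δ Γ
  | A_pair_v =>
      ∀ Δ ∈ Con, ∀ Γ ∈ Con, ∀ A ∈ Ty Γ, ∀ σ ∈ Sub Δ Γ, ∀ t ∈ Tm Δ (tyS Δ Γ A σ),
      ⊢ tmS Δ (ext Γ A) (tyS (ext Γ A) Γ A (p Γ A)) (v Γ A) (pairS Δ Γ A σ t) ≡ t
        ∈ Tm Δ (tyS Δ Γ A σ)
  | A_pair_comp =>
      ∀ Θ ∈ Con, ∀ Δ ∈ Con, ∀ Γ ∈ Con, ∀ A ∈ Ty Γ,
      ∀ σ ∈ Sub Δ Γ, ∀ t ∈ Tm Δ (tyS Δ Γ A σ), ∀ τ ∈ Sub Θ Δ,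
      ⊢ comp Θ Δ (ext Γ A) (pairS Δ Γ A σ t) τ
        ≡ pairS Θ Γ A (comp Θ Δ Γ σ τ) (tmS Θ Δ (tyS Δ Γ A σ) t τ)
        ∈ Sub Θ (ext Γ A)
  | A_pair_eta =>
      ∀ Γ ∈ Con, ∀ A ∈ Ty Γ,
      ⊢ pairS (ext Γ A) Γ A (p Γ A) (v Γ A) ≡ idS (ext Γ A)
        ∈ Sub (ext Γ A) (ext Γ A)
  | A_cneg_invol => ∀ Γ ∈ Con, ⊢ cneg (cneg Γ) ≡ Γ ∈ Con
  | A_sneg_id =>
      ∀ Γ ∈ Con, ⊢ sneg Γ Γ (idS Γ) ≡ idS (cneg Γ) ∈ Sub (cneg Γ) (cneg Γ)
  | A_sneg_comp =>
      ∀ Θ ∈ Con, ∀ Δ ∈ Con, ∀ Γ ∈ Con, ∀ σ ∈ Sub Δ Γ, ∀ τ ∈ Sub Θ Δ,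
      ⊢ sneg Θ Γ (comp Θ Δ Γ σ τ)
        ≡ comp (cneg Θ) (cneg Δ) (cneg Γ) (sneg Δ Γ σ) (sneg Θ Δ τ)
        ∈ Sub (cneg Θ) (cneg Γ)
  | A_sneg_invol =>
      ∀ Δ ∈ Con, ∀ Γ ∈ Con, ∀ σ ∈ Sub Δ Γ,
      ⊢ sneg (cneg Δ) (cneg Γ) (sneg Δ Γ σ) ≡ σ ∈ Sub Δ Γ
  | A_tneg_invol => ∀ Γ ∈ Con, ∀ A ∈ Ty Γ, ⊢ tneg Γ (tneg Γ A) ≡ A ∈ Ty Γ
  | A_tneg_sub =>
      ∀ Δ ∈ Con, ∀ Γ ∈ Con, ∀ A ∈ Ty Γ, ∀ σ ∈ Sub Δ Γ,
      ⊢ tneg Δ (tyS Δ Γ A σ) ≡ tyS Δ Γ (tneg Γ A) σ ∈ Ty Δ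
  | A_NCon_irr =>
      ∀ Γ ∈ Con, ∀ n ∈ NCon Γ, ∀ n' ∈ NCon Γ, ⊢ n ≡ n' ∈ NCon Γ
  | A_NTy_irr =>
      ∀ Γ ∈ Con, ∀ A ∈ Ty Γ, ∀ a ∈ NTy Γ A, ∀ a' ∈ NTy Γ A, ⊢ a ≡ a' ∈ NTy Γ A
  | A_e_inv_l =>
      ∀ Γ ∈ Con, ∀ n ∈ NCon Γ,
      ⊢ comp Γ (cneg Γ) Γ (sneg Γ (cneg Γ) (e Γ n)) (e Γ n) ≡ idS Γ ∈ Sub Γ Γ
  | A_e_inv_r =>
      ∀ Γ ∈ Con, ∀ n ∈ NCon Γ,
      ⊢ comp (cneg Γ) Γ (cneg Γ) (e Γ n) (sneg Γ (cneg Γ) (e Γ n))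
        ≡ idS (cneg Γ) ∈ Sub (cneg Γ) (cneg Γ)
  | A_neg_invol =>
      ∀ Γ ∈ Con, ∀ n ∈ NCon Γ, ∀ A ∈ Ty Γ, ∀ t ∈ Tm Γ A,
      ⊢ neg Γ n (tneg Γ A) (neg Γ n A t) ≡ t ∈ Tm Γ A
  | A_neg_sub =>
      ∀ Δ ∈ Con, ∀ nΔ ∈ NCon Δ, ∀ Γ ∈ Con, ∀ n ∈ NCon Γ,
      ∀ A ∈ Ty Γ, ∀ t ∈ Tm Γ A, ∀ σ ∈ Sub Δ Γ,
      ⊢ tmS Δ Γ (tneg Γ A) (neg Γ n A t) σ
        ≡ neg Δ nΔ (tyS Δ Γ A σ) (tmS Δ Γ A t σ)
        ∈ Tm Δ (tyS Δ Γ (tneg Γ A) σ)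
  | A_eext_inv_l =>
      ∀ Γ ∈ Con, ∀ n ∈ NCon Γ, ∀ A ∈ Ty (cneg Γ),
      ⊢ comp (ext Γ (tyS Γ (cneg Γ) A (e Γ n))) (extN Γ A)
             (ext Γ (tyS Γ (cneg Γ) A (e Γ n))) (eext_inv Γ n A) (eext Γ n A)
        ≡ idS (ext Γ (tyS Γ (cneg Γ) A (e Γ n)))
        ∈ Sub (ext Γ (tyS Γ (cneg Γ) A (e Γ n))) (ext Γ (tyS Γ (cneg Γ) A (e Γ n)))
  | A_eext_inv_r =>
      ∀ Γ ∈ Con, ∀ n ∈ NCon Γ, ∀ A ∈ Ty (cneg Γ),
      ⊢ comp (extN Γ A) (ext Γ (tyS Γ (cneg Γ) A (e Γ n))) (extN Γ A)
             (eext Γ n A) (eext_inv Γ n A)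
        ≡ idS (extN Γ A) ∈ Sub (extN Γ A) (extN Γ A)
  | A_eext_p =>
      ∀ Γ ∈ Con, ∀ n ∈ NCon Γ, ∀ A ∈ Ty (cneg Γ),
      ⊢ comp (ext Γ (tyS Γ (cneg Γ) A (e Γ n))) (extN Γ A) Γ
             (pN Γ A) (eext Γ n A)
        ≡ p Γ (tyS Γ (cneg Γ) A (e Γ n))
        ∈ Sub (ext Γ (tyS Γ (cneg Γ) A (e Γ n))) Γ
  | A_eext_pair =>
      ∀ Γ ∈ Con, ∀ n ∈ NCon Γ, ∀ A ∈ Ty (cneg Γ),
      ∀ t ∈ Tm (cneg Γ) (tneg (cneg Γ) A),
      ⊢ pairN Γ Γ A (idS Γ) t
        ≡ comp Γ (ext Γ (tyS Γ (cneg Γ) A (e Γ n))) (extN Γ A) (eext Γ n A)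
            (sub1 Γ (tyS Γ (cneg Γ) A (e Γ n))
               (neg Γ n (tneg Γ (tyS Γ (cneg Γ) A (e Γ n)))
                  (tmS Γ (cneg Γ) (tneg (cneg Γ) A) t (e Γ n))))
        ∈ Sub Γ (extN Γ A)
  | A_hom_sub =>
      ∀ Δ ∈ Con, ∀ Γ ∈ Con, ∀ A ∈ Ty Γ, ∀ t ∈ Tm Γ (tneg Γ A), ∀ t' ∈ Tm Γ A,
      ∀ σ ∈ Sub Δ Γ,
      ⊢ tyS Δ Γ (hom Γ A t t') σ
        ≡ hom Δ (tyS Δ Γ A σ) (tmS Δ Γ (tneg Γ A) t σ) (tmS Δ Γ A t' σ) ∈ Ty Δ
  | A_refl_sub =>
      ∀ Δ ∈ Con, ∀ nΔ ∈ NCon Δ, ∀ Γ ∈ Con, ∀ n ∈ NCon Γ,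
      ∀ A ∈ Ty Γ, ∀ t ∈ Tm Γ (tneg Γ A), ∀ σ ∈ Sub Δ Γ,
      ⊢ tmS Δ Γ (hom Γ A t (neg Γ n (tneg Γ A) t)) (reflT Γ n A t) σ
        ≡ reflT Δ nΔ (tyS Δ Γ A σ) (tmS Δ Γ (tneg Γ A) t σ)
        ∈ Tm Δ (tyS Δ Γ (hom Γ A t (neg Γ n (tneg Γ A) t)) σ)
  | A_J_beta =>
      ∀ Γ ∈ Con, ∀ n ∈ NCon Γ, ∀ A ∈ Ty Γ, ∀ t ∈ Tm Γ (tneg Γ A),
      ∀ M ∈ Ty (hom_ctx Γ A t),
      ∀ m ∈ Tm Γ (tyS Γ (hom_ctx Γ A t) M (refl_sub Γ n A t)),
      ⊢ tmS Γ (hom_ctx Γ A t) M (J Γ n A t M m) (refl_sub Γ n A t) ≡ m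
        ∈ Tm Γ (tyS Γ (hom_ctx Γ A t) M (refl_sub Γ n A t))
  | A_J_sub =>
      ∀ Δ ∈ Con, ∀ nΔ ∈ NCon Δ, ∀ Γ ∈ Con, ∀ n ∈ NCon Γ,
      ∀ A ∈ Ty Γ, ∀ t ∈ Tm Γ (tneg Γ A), ∀ M ∈ Ty (hom_ctx Γ A t),
      ∀ m ∈ Tm Γ (tyS Γ (hom_ctx Γ A t) M (refl_sub Γ n A t)), ∀ σ ∈ Sub Δ Γ,
      ⊢ tmS (hom_ctx Δ (tyS Δ Γ A σ) (tmS Δ Γ (tneg Γ A) t σ)) (hom_ctx Γ A t) M
            (J Γ n A t M m) (hom_lift Δ Γ A t σ)
        ≡ J Δ nΔ (tyS Δ Γ A σ) (tmS Δ Γ (tneg Γ A) t σ)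
            (tyS (hom_ctx Δ (tyS Δ Γ A σ) (tmS Δ Γ (tneg Γ A) t σ)) (hom_ctx Γ A t)
               M (hom_lift Δ Γ A t σ))
            (tmS Δ Γ (tyS Γ (hom_ctx Γ A t) M (refl_sub Γ n A t)) m σ)
        ∈ Tm (hom_ctx Δ (tyS Δ Γ A σ) (tmS Δ Γ (tneg Γ A) t σ))
             (tyS (hom_ctx Δ (tyS Δ Γ A σ) (tmS Δ Γ (tneg Γ A) t σ)) (hom_ctx Γ A t)
                M (hom_lift Δ Γ A t σ))
  | A_Pi_sub =>
      ∀ Δ ∈ Con, ∀ Γ ∈ Con, ∀ A ∈ Ty (cneg Γ), ∀ B ∈ Ty (extN Γ A), ∀ σ ∈ Sub Δ Γ,
      ⊢ tyS Δ Γ (Pi Γ A B) σ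
        ≡ Pi Δ (tyS (cneg Δ) (cneg Γ) A (sneg Δ Γ σ))
            (tyS (extN Δ (tyS (cneg Δ) (cneg Γ) A (sneg Δ Γ σ))) (extN Γ A) B
               (liftN Δ Γ A σ))
        ∈ Ty Δ
  | A_app_sub =>
      ∀ Δ ∈ Con, ∀ Γ ∈ Con, ∀ A ∈ Ty (cneg Γ), ∀ B ∈ Ty (extN Γ A),
      ∀ f ∈ Tm Γ (Pi Γ A B), ∀ σ ∈ Sub Δ Γ,
      ⊢ tmS (extN Δ (tyS (cneg Δ) (cneg Γ) A (sneg Δ Γ σ))) (extN Γ A) B
            (app Γ A B f) (liftN Δ Γ A σ)
        ≡ app Δ (tyS (cneg Δ) (cneg Γ) A (sneg Δ Γ σ))
            (tyS (extN Δ (tyS (cneg Δ) (cneg Γ) A (sneg Δ Γ σ))) (extN Γ A) B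
               (liftN Δ Γ A σ))
            (tmS Δ Γ (Pi Γ A B) f σ)
        ∈ Tm (extN Δ (tyS (cneg Δ) (cneg Γ) A (sneg Δ Γ σ)))
             (tyS (extN Δ (tyS (cneg Δ) (cneg Γ) A (sneg Δ Γ σ))) (extN Γ A) B
                (liftN Δ Γ A σ))
  | A_beta =>
      ∀ Γ ∈ Con, ∀ A ∈ Ty (cneg Γ), ∀ B ∈ Ty (extN Γ A), ∀ b ∈ Tm (extN Γ A) B,
      ⊢ app Γ A B (lam Γ A B b) ≡ b ∈ Tm (extN Γ A) B
  | A_eta =>
      ∀ Γ ∈ Con, ∀ A ∈ Ty (cneg Γ), ∀ B ∈ Ty (extN Γ A), ∀ f ∈ Tm Γ (Pi Γ A B),
      ⊢ lam Γ A B (app Γ A B f) ≡ f ∈ Tm Γ (Pi Γ A B)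
  | A_univ_l =>
      ∀ X ∈ Tm emp (tneg emp SET), ∀ Y ∈ Tm emp SET, ∀ h ∈ Tm emp (hom emp SET X Y),
      ⊢ func_to_hom X Y (hom_to_func X Y h) ≡ h ∈ Tm emp (hom emp SET X Y)
  | A_univ_r =>
      ∀ X ∈ Tm emp (tneg emp SET), ∀ Y ∈ Tm emp SET,
      ∀ f ∈ Tm emp (arr emp (El_dom X) (El_pos Y)),
      ⊢ hom_to_func X Y (func_to_hom X Y f) ≡ f
        ∈ Tm emp (arr emp (El_dom X) (El_pos Y))
  end.

Definition DCwF_SET : gat := Gat dsort_decl dop_decl dax_decl.

(* Main.v *)
(* The countermodel is a preorder version of the category model.  Contexts are
   preorders, types are opfibrations with finite fibres (so that the elements of
   a Π-type can be coded by natural numbers), negation is the opposite preorder,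
   and hom(t, t') is the truth value of t ≤ t'.  Only the empty context is
   neutral, so J, refl and term negation concern closed types only, and SET and
   El are singletons, which makes directed univalence trivial.  In the closed
   type {0 ≤ 1}, hom(0, 1) is inhabited but hom(1, 0) is not.  Raw expressions
   are interpreted totally, with junk on ill-typed arguments, and every equation
   of the theory holds as an equality of values, so soundness is an induction on
   derivations. *)

Require Import Defs.
From mathcomp Require Import all_boot boolp classical_sets.
From Stdlib Require Cantor.

Set Implicit Arguments.
Unset Strict Implicit.
Unset Printing Implicit Defensive.

(** * Soundness of generalized algebraic theories *)

Lemma term_nested_ind (O : Type) (P : term O -> Prop) :
  (forall i, P (Var i)) ->
  (forall f ts, foldr (fun t Q => P t /\ Q) True ts -> P (Op f ts)) ->
  forall t, P t.
Proof.
move=> PV PO; fix IH 1 => -[i|f ts]; first exact: PV.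
by apply: PO; elim: ts => [|t ts IHts] //=; split.
Qed.

Section Soundness.

Variables (T : gat) (U : Type).
Variables (iop : op_sym T -> seq U -> U) (isort : sort_sym T -> seq U -> U -> Prop).

Notation sort_expr := (sort_expr (sort_sym T) (op_sym T)).

Fixpoint eval (ρ : nat -> U) (t : term (op_sym T)) : U :=
  match t with
  | Var i => ρ i
  | Op f ts => iop f (map (eval ρ) ts)
  end.

Definition eval_sort (ρ : nat -> U) (s : sort_expr) : U -> Prop :=
  isort (sort_head s) (map (eval ρ) (sort_args s)).

Fixpoint sat_from (n : nat) (Γ : seq sort_expr) (ρ : nat -> U) : Prop :=
  match Γ with
  | [::] => True
  | s :: Γ' => eval_sort ρ s (ρ n) /\ sat_from n.+1 Γ' ρ
  end.

Definition valid_op (f : op_sym T) : Prop :=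
  forall ρ : nat -> U,
  sat_from 0 (tele_ctx (op_decl f)) ρ ->
  eval_sort ρ (tele_body (op_decl f)) (iop f (mkseq ρ (size (tele_ctx (op_decl f))))).

Definition valid_ax (a : ax_sym T) : Prop :=
  forall ρ : nat -> U,
  sat_from 0 (tele_ctx (ax_decl a)) ρ ->
  eval ρ (eq_lhs (tele_body (ax_decl a))) = eval ρ (eq_rhs (tele_body (ax_decl a))).

(** Both kinds of equality judgment become equality in the metatheory, and the sort of a term
    equation is dropped, so the conversion rules are plain rewriting. *)
Definition holds (ρ : nat -> U) (j : judgment (sort_sym T) (op_sym T)) : Prop :=
  match j with
  | HasSort t s => eval_sort ρ s (eval ρ t)
  | EqSort s s' => eval_sort ρ s = eval_sort ρ s'
  | EqTerm t t' _ => eval ρ t = eval ρ t'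
  end.

(* [subst] leaves variables beyond [size θ] unchanged, hence the default. *)
Definition eval_env (ρ : nat -> U) (θ : seq (term (op_sym T))) (i : nat) : U :=
  eval ρ (nth (Var i) θ i).

Lemma eval_subst ρ θ t : eval ρ (subst θ t) = eval (eval_env ρ θ) t.
Proof.
elim/term_nested_ind: t => [i|f ts IH] //=; congr iop.
by elim: ts IH => [|t ts IHts] //= [-> /IHts ->].
Qed.

Lemma eval_sort_subst ρ θ s :
  eval_sort ρ (sort_subst θ s) = eval_sort (eval_env ρ θ) s.
Proof.
by rewrite /eval_sort /=; congr isort; rewrite -map_comp; apply/eq_map => t /=;
   rewrite eval_subst.
Qed.

Lemma sat_fromP n Γ ρ :
  sat_from n Γ ρ <-> forall i s, onth Γ i = Some s -> eval_sort ρ s (ρ (n + i)).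
Proof.
elim: Γ n => [|s Γ IH] n /=; first by split=> // _ i s; rewrite onth0n.
split=> [[Hs /IH H] [|i] s' /=|H].
- by case=> <-; rewrite addn0.
- by move=> /H; rewrite addSnnS.
split; first by have := H 0 s erefl; rewrite addn0.
by apply/IH => i s' Hi; rewrite addSnnS; apply: H.
Qed.

Lemma sat_env ρ θ Γ :
  size θ = size Γ ->
  (forall i t s, onth θ i = Some t -> onth Γ i = Some s ->
     eval_sort ρ (sort_subst θ s) (eval ρ t)) ->
  sat_from 0 Γ (eval_env ρ θ).
Proof.
move=> sz H; apply/sat_fromP => i s Hi; rewrite add0n.
have lti : i < size θ by rewrite sz -onthTE Hi.
rewrite -eval_sort_subst /eval_env.
by apply: (H i) => //; rewrite onthE (nth_map (Var i)).
Qed.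

Lemma map_eval_env ρ θ : map (eval ρ) θ = mkseq (eval_env ρ θ) (size θ).
Proof.
apply: (@eq_from_nth _ (ρ 0)); first by rewrite size_map size_mkseq.
by move=> i; rewrite size_map => lti; rewrite nth_mkseq // (nth_map (Var i)).
Qed.

Lemma map_eval_eq ρ θ θ' (Γ : seq sort_expr) :
  size θ = size Γ -> size θ' = size Γ ->
  (forall i t t' s, onth θ i = Some t -> onth θ' i = Some t' -> onth Γ i = Some s ->
     eval ρ t = eval ρ t') ->
  map (eval ρ) θ = map (eval ρ) θ'.
Proof.
elim: Γ θ θ' => [|s Γ IH] [|t θ] [|t' θ'] //= [sz] [sz'] H.
congr cons; first exact: (H 0 t t' s).
by apply: IH => // i u u' s' ? ? ?; apply: (H i.+1 u u' s').
Qed.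

Theorem soundness (Γ : seq sort_expr) (j : judgment (sort_sym T) (op_sym T)) (ρ : nat -> U) :
  (forall f, valid_op f) -> (forall a, valid_ax a) ->
  derivable Γ j -> sat_from 0 Γ ρ -> holds ρ j.
Proof.
move=> Vop Vax D sat; elim: {j} D => /=.
- by move=> i s Hi; move/sat_fromP: sat => /(_ i s Hi).
- move=> f θ sz _ IH; rewrite eval_sort_subst map_eval_env sz.
  by apply/Vop/sat_env.
- by move=> t s s' _ Ht _ <-.
- by move=> S θ θ' sz sz' _ IH; rewrite /eval_sort /= (map_eval_eq sz sz' IH).
- by [].
- by move=> s s' s'' _ -> _.
- by [].
- by [].
- by move=> t t' t'' s _ -> _.
- by [].
- by move=> f θ θ' sz sz' _ IH; rewrite (map_eval_eq sz sz' IH).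
- by move=> a θ sz _ IH; rewrite !eval_subst; apply/Vax/sat_env.
Qed.

End Soundness.

(** * Preorders and opfibrations *)

Definition nrel := nat -> nat -> Prop.

Implicit Types (Γ Δ Θ A B M R S : nrel) (σ τ t f : nat -> nat).

Definition pr (x y : nat) : nat := Cantor.to_nat (x, y).
Definition pr1 (z : nat) : nat := (Cantor.of_nat z).1.
Definition pr2 (z : nat) : nat := (Cantor.of_nat z).2.

Lemma prK1 x y : pr1 (pr x y) = x.
Proof. by rewrite /pr1 /pr Cantor.cancel_of_to. Qed.

Lemma prK2 x y : pr2 (pr x y) = y.
Proof. by rewrite /pr2 /pr Cantor.cancel_of_to. Qed.

Lemma pr_eta z : pr (pr1 z) (pr2 z) = z.
Proof. by rewrite /pr -surjective_pairing Cantor.cancel_to_of. Qed.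

Definition prE := (prK1, prK2, pr_eta).

Lemma rel_ext R S : (forall x y, R x y <-> S x y) -> R = S.
Proof. by move=> H; apply/funext=> x; apply/funext=> y; apply/propext. Qed.

(* A preorder on its field [{x | R x x}]. *)
Record is_con R : Prop := IsCon {
  con_refl : forall x y, R x y -> R x x /\ R y y;
  con_trans : forall x y z, R x y -> R y z -> R x z }.

(** Opcartesian arrows in a preorder: factorizations are unique automatically, so only their
    existence is required. *)
Definition opcart Γ A (z w : nat) : Prop :=
  A z w /\ forall u, A z u -> Γ (pr1 w) (pr1 u) -> A w u.

Definition fib A (γ : nat) : nat -> Prop := fun a => A (pr γ a) (pr γ a).

(* A type over Γ is identified with its total preorder, which lives on codes of
   pairs.  Transport along Γ is not part of the data: it is only required to
   exist, which avoids strictness conditions. *)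
Record is_ty Γ A : Prop := IsTy {
  ty_con : is_con A;
  ty_base : forall z w, A z w -> Γ (pr1 z) (pr1 w);
  ty_lift : forall z γ, A z z -> Γ (pr1 z) γ -> exists a, opcart Γ A z (pr γ a);
  ty_fin : forall γ, exists s : seq nat, forall a, fib A γ a -> a \in s }.

(* Substitutions and terms vanish outside the field of their domain, so that
   extensionally equal ones are equal. *)
Definition normal Γ f : Prop := forall x, ~ Γ x x -> f x = 0.

Record is_sub Δ Γ σ : Prop := IsSub {
  sub_normal : normal Δ σ;
  sub_mono : forall x y, Δ x y -> Γ (σ x) (σ y) }.

Record is_tm Γ A t : Prop := IsTm {
  tm_normal : normal Γ t;
  tm_mono : forall x y, Γ x y -> A (pr x (t x)) (pr y (t y)) }.

Definition restr Γ f : nat -> nat := fun x => if `[< Γ x x >] then f x else 0.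

Lemma restrE Γ f x : Γ x x -> restr Γ f x = f x.
Proof. by rewrite /restr => /asboolT ->. Qed.

Lemma restr_normal Γ f : normal Γ (restr Γ f).
Proof. by rewrite /normal /restr => x /asboolF ->. Qed.

Lemma normal_ext Γ f g :
  normal Γ f -> normal Γ g -> (forall x, Γ x x -> f x = g x) -> f = g.
Proof.
move=> nf ng fg; apply/funext=> x; have [/fg //|nx] := pselect (Γ x x).
by rewrite nf ?ng.
Qed.

Lemma restr_id Γ f g : normal Γ g -> (forall x, Γ x x -> f x = g x) -> restr Γ f = g.
Proof.
move=> ng fg; apply: (normal_ext (restr_normal _)) => // x Γx.
by rewrite restrE ?fg.
Qed.

Lemma eq_restr Γ f g : (forall x, Γ x x -> f x = g x) -> restr Γ f = restr Γ g.
Proof.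
by move=> fg; apply: restr_id => [|x Γx]; [exact: restr_normal|rewrite restrE ?fg].
Qed.

(** * The CwF structure of preorders and opfibrations *)

Definition m_id Γ := restr Γ id.
Definition m_comp Θ σ τ := restr Θ (σ \o τ).
Definition m_emp : nrel := fun x y => x = 0 /\ y = 0.
Definition m_eps : nat -> nat := fun=> 0.
Definition m_ty Δ A σ : nrel := fun z w =>
  Δ (pr1 z) (pr1 w) /\ A (pr (σ (pr1 z)) (pr2 z)) (pr (σ (pr1 w)) (pr2 w)).
Definition m_pair Δ σ t := restr Δ (fun x => pr (σ x) (t x)).
Definition m_p A := restr A pr1.
Definition m_v A := restr A pr2.
Definition m_op Γ : nrel := fun x y => Γ y x.
(* The fibrewise opposite: over γ ≤ γ', a ≤ a' holds when a' lies below the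
   transport of a to γ', i.e. below everything over γ' that is above a. *)
Definition m_tneg Γ A : nrel := fun z w =>
  [/\ Γ (pr1 z) (pr1 w), A z z, A w w
    & forall u, pr1 u = pr1 w -> A z u -> A w u].
Definition m_hom Γ A t t' : nrel := fun z w =>
  [/\ Γ (pr1 z) (pr1 w), pr2 z = 0, pr2 w = 0
    & A (pr (pr1 z) (t (pr1 z))) (pr (pr1 z) (t' (pr1 z)))].

Lemma op_con Γ : is_con Γ -> is_con (m_op Γ).
Proof.
case=> r tr; split=> [x y /r []|x y z xy yz]; first by split.
exact: tr yz xy.
Qed.

Lemma restr_sub Δ Γ f : is_con Δ ->
  (forall x y, Δ x y -> Γ (f x) (f y)) -> is_sub Δ Γ (restr Δ f).
Proof.
move=> cΔ H; split=> [|x y xy]; first exact: restr_normal.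
by have [x1 y1] := con_refl cΔ xy; rewrite !restrE //; apply: H.
Qed.

Lemma restr_tm Γ A f : is_con Γ ->
  (forall x y, Γ x y -> A (pr x (f x)) (pr y (f y))) -> is_tm Γ A (restr Γ f).
Proof.
move=> cΓ H; split=> [|x y xy]; first exact: restr_normal.
by have [x1 y1] := con_refl cΓ xy; rewrite !restrE //; apply: H.
Qed.

Lemma id_sub Γ : is_con Γ -> is_sub Γ Γ (m_id Γ).
Proof. by move=> c; apply: restr_sub. Qed.

Lemma comp_sub Θ Δ Γ σ τ : is_con Θ ->
  is_sub Δ Γ σ -> is_sub Θ Δ τ -> is_sub Θ Γ (m_comp Θ σ τ).
Proof.
by move=> c sσ sτ; apply: restr_sub => // x y xy ; exact (sub_mono sσ (sub_mono sτ xy)).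
Qed.

Lemma emp_con : is_con m_emp.
Proof. by split=> [x y [-> ->]|x y z [-> _] [_ ->]]; split. Qed.

Lemma eps_sub Γ : is_sub Γ m_emp m_eps.
Proof. by split. Qed.

Lemma eps_uniq Γ σ : is_sub Γ m_emp σ -> σ = m_eps.
Proof.
case=> n m; apply/funext=> x; have [/m []//|/n //] := pselect (Γ x x).
Qed.

Lemma ty_ty Δ Γ A σ : is_con Δ -> is_ty Γ A -> is_sub Δ Γ σ -> is_ty Δ (m_ty Δ A σ).
Proof.
move=> cΔ tA sσ; split.
- split=> [x y [/(con_refl cΔ) [? ?] /(con_refl (ty_con tA)) [? ?]] //|x y z].
  case=> ? ? [? ?]; split; first exact: con_trans (pr1 y) _ _ _.
  by apply: con_trans; [exact: ty_con tA| |]; eassumption.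
- by move=> z w [].
- move=> z δ [zz Azz] zδ.
  have := ty_lift tA Azz; rewrite prE => /(_ _ (sub_mono sσ zδ)) [a [Aza ua]].
  exists a; split; first by rewrite /m_ty !prE.
  rewrite /m_ty !prE => u [zu Azu] δu; split=> //; apply: ua => //.
  by rewrite !prE; exact (sub_mono sσ δu).
- move=> δ; have [s Hs] := ty_fin tA (σ δ); exists s => a [_].
  by rewrite !prE; apply: Hs.
Qed.

Lemma tm_tm Δ Γ A t σ : is_con Δ -> is_tm Γ A t -> is_sub Δ Γ σ ->
  is_tm Δ (m_ty Δ A σ) (m_comp Δ t σ).
Proof.
move=> cΔ tt sσ; apply: restr_tm => // x y xy; rewrite /m_ty !prE; split=> //=.
exact (tm_mono tt (sub_mono sσ xy)).
Qed.

Lemma pair_sub Δ Γ A σ t : is_con Δ ->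
  is_sub Δ Γ σ -> is_tm Δ (m_ty Δ A σ) t -> is_sub Δ A (m_pair Δ σ t).
Proof.
move=> cΔ sσ tt; apply: restr_sub => // x y /(tm_mono tt).
by rewrite /m_ty !prE => -[].
Qed.

Lemma p_sub Γ A : is_ty Γ A -> is_sub A Γ (m_p A).
Proof. by move=> tA; apply: restr_sub (ty_con tA) (ty_base tA). Qed.

Lemma v_tm Γ A : is_ty Γ A -> is_tm A (m_ty A A (m_p A)) (m_v A).
Proof.
move=> tA; apply: restr_tm (ty_con tA) _ => x y xy; rewrite /m_ty !prE; split=> //.
by have [? ?] := con_refl (ty_con tA) xy; rewrite /m_p !restrE // !prE.
Qed.

Lemma ty_id Γ A : is_con Γ -> is_ty Γ A -> m_ty Γ A (m_id Γ) = A.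
Proof.
move=> cΓ tA; apply: rel_ext => z w; split=> [[zw]|zw].
  by have [? ?] := con_refl cΓ zw; rewrite /m_id !restrE // !prE.
have Γzw := ty_base tA zw; split=> //.
by have [? ?] := con_refl cΓ Γzw; rewrite /m_id !restrE // !prE.
Qed.

Lemma ty_comp Θ Δ A σ τ : is_con Θ -> is_sub Θ Δ τ ->
  m_ty Θ A (m_comp Θ σ τ) = m_ty Θ (m_ty Δ A σ) τ.
Proof.
move=> cΘ sτ; apply: rel_ext => z w; rewrite /m_ty !prE.
split=> [[zw]|[zw [_]]]; have [? ?] := con_refl cΘ zw;
  rewrite /m_comp !restrE //= => ?; split=> //; split=> //.
exact (sub_mono sτ zw).
Qed.

Lemma comp_assoc Ξ Θ σ τ f : is_con Ξ -> is_sub Ξ Θ f ->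
  m_comp Ξ (m_comp Θ σ τ) f = m_comp Ξ σ (m_comp Ξ τ f).
Proof.
move=> cΞ sf; apply: eq_restr => x xx /=.
by rewrite /m_comp !restrE //; exact (sub_mono sf xx).
Qed.

Lemma comp_idl Δ Γ σ : is_con Δ -> is_sub Δ Γ σ -> m_comp Δ (m_id Γ) σ = σ.
Proof.
move=> cΔ sσ; apply: restr_id (sub_normal sσ) _ => x xx /=.
by rewrite /m_id restrE //; exact (sub_mono sσ xx).
Qed.

Lemma comp_idr Γ f : normal Γ f -> m_comp Γ f (m_id Γ) = f.
Proof. by move=> nf; apply: restr_id nf _ => x xx /=; rewrite /m_id restrE. Qed.

Lemma pair_p Δ A σ t : is_tm Δ (m_ty Δ A σ) t -> normal Δ σ ->
  m_comp Δ (m_p A) (m_pair Δ σ t) = σ.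
Proof.
move=> tt nσ; apply: restr_id => // x xx /=; rewrite /m_pair restrE //.
by have := tm_mono tt xx; rewrite /m_ty !prE => -[_ ?]; rewrite /m_p restrE ?prE.
Qed.

Lemma pair_v Δ A σ t : is_tm Δ (m_ty Δ A σ) t ->
  m_comp Δ (m_v A) (m_pair Δ σ t) = t.
Proof.
move=> tt; apply: restr_id (tm_normal tt) _ => // x xx /=; rewrite /m_pair restrE //.
by have := tm_mono tt xx; rewrite /m_ty !prE => -[_ ?]; rewrite /m_v restrE ?prE.
Qed.

Lemma pair_comp Θ Δ σ t τ : is_sub Θ Δ τ ->
  m_comp Θ (m_pair Δ σ t) τ = m_pair Θ (m_comp Θ σ τ) (m_comp Θ t τ).
Proof.
move=> sτ; apply: eq_restr => x xx /=.
by rewrite /m_pair /m_comp !restrE //=; exact (sub_mono sτ xx).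
Qed.

Lemma pair_eta A : m_pair A (m_p A) (m_v A) = m_id A.
Proof. by apply: eq_restr => x xx; rewrite /m_p /m_v !restrE // prE. Qed.

(** * Negation of types as the fibrewise opposite *)

Lemma tneg_ty Γ A : is_con Γ -> is_ty Γ A -> is_ty Γ (m_tneg Γ A).
Proof.
move=> cΓ tA; have cA := ty_con tA; split.
- split=> [z w [zw zz ww _]|z w u [zw zz ww wz] [wu _ uu uw]].
    by have [? ?] := con_refl cΓ zw; split; split.
  split=> //; first exact: con_trans zw wu.
  move=> x xu zx.
  (* Here [b] is the transport of [z] to the fibre of [w], and [c] that of [b] to the fibre of [u].
     From [w] ≤ [b] ≤ [c] follows [u] ≤ [c], and any [x] over [u] that is above [z] is above [b],
     hence above [c]. *)
  have [b [zb ub]] := ty_lift tA zz zw.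
  have wb : A w (pr (pr1 w) b) by apply: wz; rewrite ?prE.
  have [_ bb] := con_refl cA zb.
  have [c [bc uc]] : exists c, opcart Γ A (pr (pr1 w) b) (pr (pr1 u) c).
    by apply: ty_lift tA _ _ _ _; rewrite ?prE.
  have bx : A (pr (pr1 w) b) x by apply: ub => //; rewrite xu prE.
  have uc' : A u (pr (pr1 u) c) by apply: uw; rewrite ?prE //; apply: con_trans bc.
  apply: con_trans uc' _ => //.
  by apply: uc => //; rewrite prE xu; have [] := con_refl cΓ wu.
- by move=> z w [].
(* Transport in the opposite is the same as in [A]: only the order inside the fibres is reversed. *)
- move=> z γ [zz Azz _ _] zγ; have [a [za ua]] := ty_lift tA Azz zγ.
  exists a; split.
    split=> //; rewrite ?prE //; first by have [] := con_refl cA za.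
    by move=> u uγ zu; apply: ua => //; rewrite uγ prE; have [] := con_refl cΓ zγ.
  rewrite !prE => u [zu _ uu wu] γu; split=> //; first by rewrite prE.
    by have [] := con_refl cA za.
  by move=> x xu ax; apply: wu => //; apply: con_trans ax.
- move=> γ; have [s Hs] := ty_fin tA γ; exists s => a [_ ? _ _]; exact: Hs.
Qed.

Lemma tneg_vertical Γ A z w : is_con Γ -> is_ty Γ A -> pr1 z = pr1 w ->
  m_tneg Γ A z w <-> A w z.
Proof.
move=> cΓ tA zw; split=> [[_ zz _ H]|wz]; first exact: H.
have [ww zz] := con_refl (ty_con tA) wz.
split=> //; first by rewrite zw; apply: ty_base tA _ _ ww.
by move=> u _ zu; apply: con_trans wz zu; apply: ty_con tA.
Qed.

Lemma tneg_invol Γ A : is_con Γ -> is_ty Γ A -> m_tneg Γ (m_tneg Γ A) = A.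
Proof.
move=> cΓ tA; have cA := ty_con tA; apply: rel_ext => z w; split.
  case=> zw [_ zz _ _] [_ ww _ _] H.
  (* With [a] the transport of [z] to the fibre of [w], the hypothesis at [a] is an inequality
     within one fibre, where negation reverses the order. It gives [a] ≤ [w], and [z] ≤ [a] by
     construction. *)
  have [a [za ua]] := ty_lift tA zz zw.
  have [_ aa] := con_refl cA za; have [_ Γw] := con_refl cΓ zw.
  have: m_tneg Γ A w (pr (pr1 w) a).
    apply: H; rewrite ?prE //; split=> //; rewrite ?prE // => u uw zu.
    by apply: ua => //; rewrite uw prE.
  rewrite tneg_vertical ?prE // => aw.
  exact: con_trans za aw.
move=> zw; have Γzw := ty_base tA zw.
have [zz ww] := con_refl cA zw; have [Γz Γw] := con_refl cΓ Γzw.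
split=> //; try by apply/tneg_vertical.
move=> u uw [zu _ uu H]; apply/tneg_vertical => //; exact: H.
Qed.

Lemma tneg_sub Δ Γ A σ : is_con Δ -> is_sub Δ Γ σ ->
  m_tneg Δ (m_ty Δ A σ) = m_ty Δ (m_tneg Γ A) σ.
Proof.
move=> cΔ sσ; apply: rel_ext => z w; split.
  case=> zw [_ zz] [_ ww] H; split=> //; split=> //.
    by rewrite !prE; exact (sub_mono sσ zw).
  rewrite !prE => u uw zu; have Δw := con_refl cΔ zw.
  have []: m_ty Δ A σ w (pr (pr1 w) (pr2 u)).
    by apply: H; rewrite ?prE //; split; rewrite !prE // -uw prE.
  by rewrite !prE -uw prE.
case=> zw [_ zz ww H]; have [Δz Δw] := con_refl cΔ zw.
split=> // u uw [zu Au]; split; first by rewrite uw.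
by apply: H; rewrite ?prE ?uw //; move: Au; rewrite uw.
Qed.

Lemma emp_op : m_op m_emp = m_emp.
Proof. by apply: rel_ext => x y; split=> -[-> ->]. Qed.

(** There is only one fibre, so both operations reverse the same order. Hence positive and negative
    extension of the empty context agree, and [e ▷ A] can be an identity. *)
Lemma tneg_emp A : is_ty m_emp A -> m_op (m_tneg m_emp A) = A.
Proof.
move=> tA; apply: rel_ext => z w; rewrite /m_op; split=> H.
  apply/(tneg_vertical emp_con tA) => //.
  by have [-> ->] := ty_base (tneg_ty emp_con tA) H.
apply/tneg_vertical => //; first exact: emp_con.
by have [-> ->] := ty_base tA H.
Qed.

(** * Hom-types *)

Lemma hom_ty_ty Γ A t t' : is_con Γ -> is_ty Γ A ->
  is_tm Γ (m_tneg Γ A) t -> is_tm Γ A t' -> is_ty Γ (m_hom Γ A t t').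
Proof.
move=> cΓ tA tt tt'; have cA := ty_con tA.
(* This is where the polarity of [t] enters: as a section of the opposite, [t w] lies below
   everything over [w] that is above [t z], in particular below [t' w]. *)
have mono z w : Γ z w -> A (pr z (t z)) (pr z (t' z)) -> A (pr w (t w)) (pr w (t' w)).
  move=> zw H; have [_ _ _ /(_ (pr w (t' w)))] := tm_mono tt zw.
  rewrite !prE; apply => //; apply: con_trans H _ => //; exact (tm_mono tt' zw).
split.
- split=> [z w [zw z0 w0 H]|x y z [xy x0 y0 H] [yz _ z0 _]].
    have [? ?] := con_refl cΓ zw; split; split=> //; exact: mono zw H.
  split=> //; exact: con_trans yz.
- by move=> z w [].
- move=> z γ [zz z0 _ H] zγ; exists 0; split; first by split; rewrite ?prE.
  move=> u [zu _ u0 _]; rewrite prE => γu; split; rewrite ?prE //.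
  exact: mono zγ H.
- by move=> γ; exists [:: 0] => a []; rewrite !prE => _ ->; rewrite inE.
Qed.

Lemma hom_sub_eq Δ Γ A t t' σ : is_con Δ -> is_sub Δ Γ σ ->
  m_ty Δ (m_hom Γ A t t') σ = m_hom Δ (m_ty Δ A σ) (m_comp Δ t σ) (m_comp Δ t' σ).
Proof.
move=> cΔ sσ; apply: rel_ext => z w; rewrite /m_ty /m_hom !prE /m_comp.
split.
  by case=> zw [_ z0 w0 H]; have [? ?] := con_refl cΔ zw; split; rewrite ?restrE.
case=> zw z0 w0 [_]; have [? ?] := con_refl cΔ zw; rewrite !restrE //= => H.
by split=> //; split=> //; exact (sub_mono sσ zw).
Qed.

Lemma eps_id : m_eps = m_id m_emp.
Proof. by apply/esym/restr_id => // x []. Qed.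

Definition m_lift Δ A σ :=
  m_pair (m_ty Δ A σ) (m_comp (m_ty Δ A σ) σ (m_p (m_ty Δ A σ))) (m_v (m_ty Δ A σ)).

Lemma liftE Δ A σ z : m_ty Δ A σ z z -> m_lift Δ A σ z = pr (σ (pr1 z)) (pr2 z).
Proof. by move=> zz; rewrite /m_lift /m_pair /m_comp /m_p /m_v restrE // !restrE //= restrE. Qed.

Lemma lift_id Γ A : is_con Γ -> is_ty Γ A -> m_lift Γ A (m_id Γ) = m_id A.
Proof.
move=> cΓ tA; rewrite -{2}(ty_id cΓ tA); apply/esym/restr_id => [|z zz].
  exact: restr_normal.
by rewrite liftE // /m_id restrE ?prE //; case: zz.
Qed.

(** * Directed J over the empty context *)

Definition m_hom_ty A t := m_hom A (m_ty A A (m_p A)) (m_comp A t (m_p A)) (m_v A).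
Definition m_hom_sub Γ t' q := m_pair Γ (m_pair Γ (m_id Γ) t') q.
(** The image of [refl_sub]: the point given by [t] and its reflexivity. *)
Definition m_base t : nat := pr (pr 0 (t 0)) 0.
(** The base point lies below every [w], so [m] is transported from there. For well-typed arguments
    the required lift exists, so the default [0] of [xget] never occurs. *)
Definition m_J A t M m := restr (m_hom_ty A t) (fun w =>
  if w == m_base t then m 0
  else xget 0 [set a | opcart (m_hom_ty A t) M (pr (m_base t) (m 0)) (pr w a)]).

Lemma hom_ty_is_ty Γ A t : is_con Γ -> is_ty Γ A -> is_tm Γ (m_tneg Γ A) t ->
  is_ty A (m_hom_ty A t).
Proof.
move=> cΓ tA tt; have cA := ty_con tA; have sp := p_sub tA.
apply: hom_ty_ty => //; first exact: ty_ty tA sp.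
  by rewrite (tneg_sub A cA sp); exact: tm_tm cA tt sp.
exact: v_tm tA.
Qed.

Section ClosedJ.

Variables (A M : nrel) (t m : nat -> nat).
Hypotheses (tA : is_ty m_emp A) (tt : is_tm m_emp (m_tneg m_emp A) t).
Hypothesis tM : is_ty (m_hom_ty A t) M.
Hypothesis tm : is_tm m_emp (m_ty m_emp M (m_hom_sub m_emp t m_eps)) m.

Let W := m_hom_ty A t.

Lemma hom_subE t' q : m_hom_sub m_emp t' q 0 = pr (pr 0 (t' 0)) (q 0).
Proof. by rewrite /m_hom_sub /m_pair /m_id !restrE. Qed.

(** Over a one-point context the pulled back [t] is constant, so the context of J is the coslice of
    [A] under [t]. *)
Lemma hom_tyE w w' :
  W w w' <-> [/\ A (pr1 w) (pr1 w'), pr2 w = 0, pr2 w' = 0 & A (pr 0 (t 0)) (pr1 w)].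
Proof.
suff H z : A z z -> m_ty A A (m_p A) (pr z (m_comp A t (m_p A) z)) (pr z (m_v A z))
                    <-> A (pr 0 (t 0)) z.
  by split=> -[ww w0 w0' Hw]; have [zz _] := con_refl (ty_con tA) ww; split=> //;
     apply/(H _ zz).
move=> zz; have [z0 _] := ty_base tA zz.
rewrite /m_ty !prE /m_comp /m_p /m_v !restrE //= !restrE // prE z0.
by split=> [[]|].
Qed.

Lemma hom_ty_base : W (m_base t) (m_base t).
Proof. by have [_ ? _ _] := tm_mono tt (conj erefl erefl); apply/hom_tyE; rewrite !prE. Qed.

(** [t] is initial in its own coslice; directed J rests on this. *)
Lemma hom_ty_from_base w : W w w -> W (m_base t) w.
Proof.
case/hom_tyE => ww w0 _ bw; have [bb _] := con_refl (ty_con tA) bw.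
by apply/hom_tyE; rewrite !prE.
Qed.

(* This also holds in the case [w = m_base t], which [m_J] treats separately to
   satisfy the β-rule strictly. *)
Lemma J_opcart w : W w w -> opcart W M (pr (m_base t) (m 0)) (pr w (m_J A t M m w)).
Proof.
move=> ww; have := tm_mono tm (conj erefl erefl).
rewrite /m_ty !prE hom_subE => -[_ Mm].
rewrite /m_J restrE //; case: eqP => [->|_].
  by split.
apply: (xgetPex 0 (P := [set a | opcart W M _ (pr w a)])).
by apply: (ty_lift tM Mm); rewrite prE; apply: hom_ty_from_base.
Qed.

Lemma J_tm : is_tm W M (m_J A t M m).
Proof.
have cW := ty_con (hom_ty_is_ty emp_con tA tt).
split=> [|w w' ww']; first exact: restr_normal.
(* Both values lie above [m 0], and the one over [w] is opcartesian, so the one over [w'] factors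
   through it. *)
have [/J_opcart [_ uw] /J_opcart [mw' _]] := con_refl cW ww'.
by apply: uw => //; rewrite !prE.
Qed.

Lemma J_beta : normal m_emp m ->
  m_comp m_emp (m_J A t M m) (m_hom_sub m_emp t m_eps) = m.
Proof.
move=> nm; apply: restr_id nm _ => x [-> _] /=; rewrite hom_subE.
by rewrite /m_J restrE ?eqxx //; exact: hom_ty_base.
Qed.

End ClosedJ.

Lemma sub_emp_id σ : is_sub m_emp m_emp σ -> σ = m_id m_emp.
Proof. by move/eps_uniq ->; exact: eps_id. Qed.

(** The one-point type, which interprets [SET] as well as [El]. *)
Definition m_unit Γ : nrel := fun z w => [/\ Γ (pr1 z) (pr1 w), pr2 z = 0 & pr2 w = 0].

Lemma unit_ty Γ : is_con Γ -> is_ty Γ (m_unit Γ).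
Proof.
move=> cΓ; split.
- split=> [z w [zw z0 w0]|x y z [xy x0 y0] [yz _ z0]].
    by have [? ?] := con_refl cΓ zw.
  split=> //; exact: con_trans yz.
- by move=> z w [].
- move=> z γ [zz z0 _] zγ; exists 0; split; first by rewrite /m_unit !prE.
  by rewrite /m_unit !prE => u [_ _ u0].
- by move=> γ; exists [:: 0] => a []; rewrite !prE => _ ->; rewrite inE.
Qed.

(** * Polarized Π-types *)

(* Functions with finite domain P are coded by their lists of values along a
   fixed enumeration of P. *)
Definition enumP (P : nat -> Prop) : seq nat :=
  xget [::] [set s | forall x, x \in s <-> P x].
Definition code (P : nat -> Prop) f : nat := pickle (map f (enumP P)).
Definition dec (P : nat -> Prop) (F a : nat) : nat :=
  nth 0 (odflt [::] (unpickle F)) (index a (enumP P)).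

Definition finiteP (P : nat -> Prop) := exists s : seq nat, forall a, P a -> a \in s.

Lemma mem_enumP P a : finiteP P -> a \in enumP P <-> P a.
Proof.
case=> s Hs; apply: (xgetPex [::] (P := [set s | forall x, x \in s <-> P x])).
exists [seq x <- s | `[< P x >]] => x; rewrite mem_filter.
split=> [/andP[/asboolP]//|Px]; apply/andP; split; [exact/asboolP|exact: Hs].
Qed.

Lemma codeK P f a : finiteP P -> P a -> dec P (code P f) a = f a.
Proof.
move=> fP Pa; have aP := (mem_enumP a fP).2 Pa.
by rewrite /dec /code pickleK /= (nth_map 0) ?index_mem // nth_index.
Qed.

Lemma eq_code P f g : finiteP P -> (forall a, P a -> f a = g a) -> code P f = code P g.
Proof.
move=> fP fg; congr pickle; apply/eq_in_map => a /(mem_enumP a fP); exact: fg.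
Qed.

(** Together with [finite_cover] this bounds the value lists of dependent functions, and so the
    fibres of a Π-type. *)
Lemma finite_seqs (L : seq nat) n :
  exists S : seq (seq nat), forall l, size l = n -> {subset l <= L} -> l \in S.
Proof.
elim: n => [|n [S HS]]; first by exists [:: [::]] => -[].
exists [seq x :: l | x <- L, l <- S] => -[|x l] //= [sz] sub.
apply/allpairsP; exists (x, l); split=> //=; first by apply: sub; rewrite mem_head.
by apply: HS => // y yl; apply: sub; rewrite inE yl orbT.
Qed.

Lemma finite_cover (s : seq nat) (Q : nat -> nat -> Prop) :
  (forall a, finiteP (Q a)) -> exists L : seq nat, forall a b, a \in s -> Q a b -> b \in L.
Proof.
move=> fQ; elim: s => [|a s [L HL]]; first by exists [::].
have [L' HL'] := fQ a; exists (L' ++ L) => x b; rewrite inE mem_cat.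
by case/orP=> [/eqP -> /HL' ->//|xs /(HL _ _ xs) ->]; rewrite orbT.
Qed.

Definition m_extN Γ A : nrel := m_op (m_tneg (m_op Γ) A).

(* z = (γ, F) with F the code of a function on the fibre of A over γ. *)
Definition m_dec A z a := dec (fib A (pr1 z)) (pr2 z) a.
(** Many numbers decode to the same function. Admitting only the canonical one yields η as an
    equality and keeps the fibres of a Π-type finite. *)
Definition m_canon A z : Prop := pr2 z = code (fib A (pr1 z)) (m_dec A z).
(** Related arguments go to related values, as in a logical relation. On the diagonal it says that
    the decoded function is a monotone section over one fibre. *)
Definition m_sec Γ A B : nrel := fun z w => forall a b,
  m_extN Γ A (pr (pr1 z) a) (pr (pr1 w) b) ->
  B (pr (pr (pr1 z) a) (m_dec A z a)) (pr (pr (pr1 w) b) (m_dec A w b)).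
Definition m_Pi Γ A B : nrel := fun z w =>
  [/\ Γ (pr1 z) (pr1 w), m_canon A z /\ m_canon A w,
      m_sec Γ A B z z, m_sec Γ A B w w & m_sec Γ A B z w].
Definition m_app Γ A f := restr (m_extN Γ A) (fun z =>
  dec (fib A (pr1 z)) (f (pr1 z)) (pr2 z)).
Definition m_lam Γ A b := restr Γ (fun γ => code (fib A γ) (fun a => b (pr γ a))).

Section PiTypes.

Variables (Γ A B : nrel).
Hypotheses (cΓ : is_con Γ) (tA : is_ty (m_op Γ) A) (tB : is_ty (m_extN Γ A) B).

Let E := m_extN Γ A.

Lemma extN_con : is_con E.
Proof. exact/op_con/ty_con/(tneg_ty (op_con cΓ) tA). Qed.

Lemma extN_base z w : E z w -> Γ (pr1 z) (pr1 w).
Proof. by case. Qed.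

Lemma extN_fib γ a : E (pr γ a) (pr γ a) <-> fib A γ a.
Proof. by apply: (tneg_vertical (op_con cΓ) tA). Qed.

(** [E] is the opposite of an opfibration over [m_op Γ], hence a fibration over [Γ]: transport of
    arguments is contravariant. *)
Lemma extN_cart w γ : E w w -> Γ γ (pr1 w) ->
  exists a, E (pr γ a) w /\ forall u, E u w -> Γ (pr1 u) γ -> E u (pr γ a).
Proof.
move=> ww γw; have [a [wa ua]] := ty_lift (tneg_ty (op_con cΓ) tA) ww γw.
by exists a; split=> // u uw uγ; apply: ua; rewrite // prE.
Qed.

Lemma Pi_con : is_con (m_Pi Γ A B).
Proof.
have cE := extN_con; split=> [z w [zw [cz cw] zz ww _]|x y z].
  by have [? ?] := con_refl cΓ zw; split; split.
case=> xy [cx _] xx _ Hxy [yz [_ cz] _ zz Hyz]; split=> //; first exact: con_trans yz.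
move=> a b ab; have [_ bb] := con_refl cE ab.
(* The inequality from [a] to [b] is factored through the cartesian lift [c] of [b] to the middle
   base point, where [y] can be evaluated. *)
have [|c [cb uc]] := extN_cart (γ := pr1 y) bb; first by rewrite prE.
apply: con_trans (ty_con tB) _ _ _ (Hxy a c _) (Hyz c b _) => //.
by apply: uc; rewrite ?prE.
Qed.

Lemma Pi_lift z γ : m_Pi Γ A B z z -> Γ (pr1 z) γ ->
  exists F, opcart Γ (m_Pi Γ A B) z (pr γ F).
Proof.
case=> Γz [cz _] zz _ _ zγ; have cE := extN_con; have cB := ty_con tB.
(* The value at b is the transport of F at a cartesian lift [c b] of b. *)
pose c b := xget 0 [set a | E (pr (pr1 z) a) (pr γ b) /\
  forall u, E u (pr γ b) -> Γ (pr1 u) (pr1 z) -> E u (pr (pr1 z) a)].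
have cP b : E (pr γ b) (pr γ b) -> E (pr (pr1 z) (c b)) (pr γ b) /\
    forall u, E u (pr γ b) -> Γ (pr1 u) (pr1 z) -> E u (pr (pr1 z) (c b)).
  move=> bb; apply: (xgetPex 0 (P := [set a | E (pr (pr1 z) a) (pr γ b) /\
    forall u, E u (pr γ b) -> Γ (pr1 u) (pr1 z) -> E u (pr (pr1 z) a)])).
  by apply: extN_cart; rewrite ?prE.
pose zc b := pr (pr (pr1 z) (c b)) (m_dec A z (c b)).
pose g b := xget 0 [set y | opcart E B (zc b) (pr (pr γ b) y)].
have gP b : E (pr γ b) (pr γ b) -> opcart E B (zc b) (pr (pr γ b) (g b)).
  move=> bb; apply: (xgetPex 0 (P := [set y | opcart E B (zc b) (pr (pr γ b) y)])).
  have [cb _] := cP b bb; apply: ty_lift tB _ _ _ _; last by rewrite !prE.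
  by apply: zz; have [] := con_refl cE cb.
have fP : finiteP (fib A γ) by apply: ty_fin tA γ.
pose F := code (fib A γ) g; exists F; pose w := pr γ F.
have decw b : E (pr γ b) (pr γ b) -> m_dec A w b = g b.
  by move/extN_fib => bb; rewrite /m_dec !prE codeK.
have cw : m_canon A w.
  rewrite /m_canon {1}/w !prE; apply: eq_code => // b bb.
  by apply/esym/decw/extN_fib.
(* Universality of [c b] makes [c] monotone; then [F] at [c a] lies below [g b], and [g a] is
   opcartesian. *)
have ww : m_sec Γ A B w w.
  rewrite /m_sec !prE => a b ab; have [aa bb] := con_refl cE ab.
  rewrite !decw //; have [ca _] := cP a aa; have [cb ub] := cP b bb.
  have [za ua] := gP a aa; have [zb _] := gP b bb.
  apply: ua; last by rewrite !prE.
  apply: con_trans cB _ _ _ (zz (c a) (c b) _) zb.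
  by apply: ub; rewrite ?prE //; apply: con_trans ab.
have zw : m_sec Γ A B z w.
  rewrite /m_sec !prE => a b ab; have [aa bb] := con_refl cE ab.
  rewrite decw //; have [cb ub] := cP b bb; have [zb _] := gP b bb.
  apply: con_trans cB _ _ _ (zz a (c b) _) zb.
  by apply: ub; rewrite ?prE.
split; first by split; rewrite ?prE.
(* For [u] above [z], its value at [d] is above the value of [z] at [c b], because [c b] ≤ [b] ≤
   [d]. Opcartesianness of [g b] then concludes. *)
move=> u [zu [_ cu] _ uu Hzu]; rewrite prE => γu; split; rewrite ?prE //.
rewrite /m_sec !prE => b d bd; have [bb dd] := con_refl cE bd.
rewrite decw //; have [cb _] := cP b bb; have [zb ub] := gP b bb.
apply: ub; last by rewrite !prE.
by apply: Hzu; apply: con_trans bd.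
Qed.

Lemma Pi_ty : is_ty Γ (m_Pi Γ A B).
Proof.
split; [exact: Pi_con|by move=> z w []|exact: Pi_lift|] => γ.
have fP : finiteP (fib A γ) by apply: ty_fin tA γ.
have [L HL] := finite_cover (enumP (fib A γ)) (fun a => ty_fin tB (pr γ a)).
have [S HS] := finite_seqs L (size (enumP (fib A γ))).
(* Canonicity forces [F] to be the pickle of a value list of fixed length, with entries in the bound
   [L]. *)
exists (map pickle S) => F [_ [+ _] zz _ _]; rewrite /m_canon !prE => ->.
apply/map_f/HS; first by rewrite size_map.
move=> b /mapP [a ain ->]; apply: (HL a) => //.
have := zz a a; rewrite !prE; apply; apply/extN_fib.
exact/(mem_enumP a fP).
Qed.

Lemma app_tm f : is_tm Γ (m_Pi Γ A B) f -> is_tm E B (m_app Γ A f).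
Proof.
move=> tf; apply: restr_tm extN_con _ => z w zw.
have [_ _ _ _ H] := tm_mono tf (extN_base zw).
have := H (pr2 z) (pr2 w); rewrite /m_dec !prE; exact.
Qed.

Lemma lam_tm b : is_tm E B b -> is_tm Γ (m_Pi Γ A B) (m_lam Γ A b).
Proof.
move=> tb; apply: restr_tm => // x y xy.
have fP γ : finiteP (fib A γ) by apply: ty_fin tA γ.
pose c γ := code (fib A γ) (fun a => b (pr γ a)).
have decc γ a : E (pr γ a) (pr γ a) -> m_dec A (pr γ (c γ)) a = b (pr γ a).
  by move/extN_fib => ?; rewrite /m_dec !prE codeK.
have canc γ : m_canon A (pr γ (c γ)).
  by rewrite /m_canon !prE; apply: eq_code => // a /extN_fib /decc ->.
have sc γ δ : m_sec Γ A B (pr γ (c γ)) (pr δ (c δ)).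
  rewrite /m_sec !prE => a d ad; have [aa dd] := con_refl extN_con ad.
  by rewrite !decc //; exact (tm_mono tb ad).
by split; rewrite ?prE.
Qed.

Lemma Pi_beta b : is_tm E B b -> m_app Γ A (m_lam Γ A b) = b.
Proof.
move=> tb; apply: restr_id (tm_normal tb) _ => z zz.
have Γz := extN_base zz; rewrite /m_lam restrE // codeK ?prE //.
  exact: ty_fin tA _.
by apply/extN_fib; rewrite prE.
Qed.

Lemma Pi_eta f : is_tm Γ (m_Pi Γ A B) f -> m_lam Γ A (m_app Γ A f) = f.
Proof.
move=> tf; apply: restr_id (tm_normal tf) _ => γ γγ.
have [_ [+ _] _ _ _] := tm_mono tf γγ; rewrite /m_canon !prE => ->.
apply: eq_code => [|a /extN_fib aa]; first exact: ty_fin tA _.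
by rewrite /m_app restrE // /m_dec !prE.
Qed.

End PiTypes.

(** * Stability of Π-types under substitution *)

Section Substitution.

Variables (Δ Γ A B : nrel) (σ : nat -> nat).
Hypotheses (cΔ : is_con Δ) (cΓ : is_con Γ) (tA : is_ty (m_op Γ) A) (sσ : is_sub Δ Γ σ).

Let Aσ := m_ty (m_op Δ) A σ.
Let l := m_lift (m_op Δ) (m_tneg (m_op Γ) A) σ.
Let Bσ := m_ty (m_extN Δ Aσ) B l.

Lemma op_sub : is_sub (m_op Δ) (m_op Γ) σ.
Proof. by split=> [|x y xy]; [exact: sub_normal sσ|exact (sub_mono sσ xy)]. Qed.

Lemma extN_sub : m_extN Δ Aσ = m_op (m_ty (m_op Δ) (m_tneg (m_op Γ) A) σ).
Proof. by rewrite /m_extN (tneg_sub A (op_con cΔ) op_sub). Qed.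

Lemma extN_subE δ a δ' a' :
  m_extN Δ Aσ (pr δ a) (pr δ' a') <-> Δ δ δ' /\ m_extN Γ A (pr (σ δ) a) (pr (σ δ') a').
Proof. by rewrite extN_sub {1}/m_op /m_ty !prE. Qed.

Lemma extN_sub_lift z : m_extN Δ Aσ z z -> l z = pr (σ (pr1 z)) (pr2 z).
Proof. by rewrite extN_sub => zz; rewrite /l liftE. Qed.

(** Because this is an equality of predicates, both sides share one enumeration and thus the same
    codes, which makes Π-types strictly stable. *)
Lemma fib_sub δ : Δ δ δ -> fib Aσ δ = fib A (σ δ).
Proof.
by move=> δδ; apply/funext=> a; apply/propext; rewrite /fib /Aσ /m_ty !prE; split=> [[]|].
Qed.

Lemma sec_sub z w : Δ (pr1 z) (pr1 w) ->
  m_sec Δ Aσ Bσ z w <-> m_sec Γ A B (pr (σ (pr1 z)) (pr2 z)) (pr (σ (pr1 w)) (pr2 w)).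
Proof.
move=> zw; have [zz ww] := con_refl cΔ zw.
have tAσ : is_ty (m_op Δ) Aσ := ty_ty (op_con cΔ) tA op_sub.
rewrite /m_sec /m_dec !prE !fib_sub //.
split=> H a b ab.
  have /H : m_extN Δ Aσ (pr (pr1 z) a) (pr (pr1 w) b) by apply/extN_subE.
  case; rewrite !prE => /(con_refl (extN_con cΔ tAσ)) [aa bb].
  by rewrite !extN_sub_lift // !prE.
have [aa bb] := con_refl (extN_con cΔ tAσ) ab.
split; rewrite !prE // !extN_sub_lift // !prE; apply: H.
by case/extN_subE: ab.
Qed.

Lemma canon_sub z : Δ (pr1 z) (pr1 z) ->
  m_canon Aσ z <-> m_canon A (pr (σ (pr1 z)) (pr2 z)).
Proof. by move=> zz; rewrite /m_canon /m_dec !prE fib_sub. Qed.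

Lemma Pi_sub : m_ty Δ (m_Pi Γ A B) σ = m_Pi Δ Aσ Bσ.
Proof.
apply: rel_ext => z w; split.
  case=> zw [+ [+ +]]; have [zz ww] := con_refl cΔ zw.
  rewrite !prE => _ cz cw sz sw szw; split=> //; try exact/sec_sub.
  by split; apply/canon_sub.
case=> zw [cz cw] sz sw szw; have [zz ww] := con_refl cΔ zw.
split=> //; split; try exact/sec_sub; first by rewrite !prE; exact (sub_mono sσ zw).
by split; apply/canon_sub.
Qed.

Lemma app_sub f :
  m_comp (m_extN Δ Aσ) (m_app Γ A f) l = m_app Δ Aσ (m_comp Δ f σ).
Proof.
apply: eq_restr => z zz /=; rewrite extN_sub_lift //.
have /extN_subE [zΔ zE] : m_extN Δ Aσ (pr (pr1 z) (pr2 z)) (pr (pr1 z) (pr2 z)).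
  by rewrite prE.
by rewrite /m_app restrE // !prE fib_sub // /m_comp restrE.
Qed.

End Substitution.

(** Stability of J concerns neutral contexts only, so the substitution is the identity of [m_emp],
    and lifting it twice gives identities again. *)
Lemma J_sub A M t m (σ := m_id m_emp) (A' := m_ty m_emp A σ) (t' := m_comp m_emp t σ)
    (l := m_lift A' (m_hom_ty A t) (m_lift m_emp A σ)) :
  is_ty m_emp A -> is_tm m_emp (m_tneg m_emp A) t -> is_ty (m_hom_ty A t) M ->
  normal m_emp m ->
  m_comp (m_hom_ty A' t') (m_J A t M m) l
  = m_J A' t' (m_ty (m_hom_ty A' t') M l) (m_comp m_emp m σ).
Proof.
move=> tA tt tM nm; have tW := hom_ty_is_ty emp_con tA tt.
have eA : A' = A := ty_id emp_con tA.
have et : t' = t := comp_idr (tm_normal tt).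
have el : l = m_id (m_hom_ty A t).
  by rewrite /l eA lift_id ?lift_id //; [exact: ty_con tA|exact: emp_con].
rewrite eA et el (comp_idr nm) (ty_id (ty_con tW) tM) comp_idr //.
exact: restr_normal.
Qed.

(** * The interpretation *)

Definition value : Type := nrel + (nat -> nat).
Definition vrel (u : value) : nrel := if u is inl R then R else m_emp.
Definition vfun (u : value) : nat -> nat := if u is inr f then f else m_eps.

(** Neutrality witnesses are the dummy [m_eps]. Term negation keeps the underlying function, since a
    section over a single point is just an element, whichever way the fibre is ordered. *)
Definition m_iop (o : dop) (l : seq value) : value :=
  let R := fun i => vrel (nth (inl m_emp) l i) in
  let F := fun i => vfun (nth (inl m_emp) l i) in
  match o with
  | O_id => inr (m_id (R 0))
  | O_comp => inr (m_comp (R 0) (F 3) (F 4))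
  | O_emp => inl m_emp
  | O_eps => inr m_eps
  | O_tyS => inl (m_ty (R 0) (R 2) (F 3))
  | O_tmS => inr (m_comp (R 0) (F 3) (F 4))
  | O_ext => inl (R 1)
  | O_pair => inr (m_pair (R 0) (F 3) (F 4))
  | O_p => inr (m_p (R 1))
  | O_v => inr (m_v (R 1))
  | O_cneg => inl (m_op (R 0))
  | O_sneg => inr (F 2)
  | O_tneg => inl (m_tneg (R 0) (R 1))
  | O_nemp | O_ncneg | O_next | O_ntyS | O_ntneg => inr m_eps
  | O_e => inr (m_id (R 0))
  | O_neg => inr (F 3)
  | O_eext | O_eext_inv => inr (m_id (R 2))
  | O_hom => inl (m_hom (R 0) (R 1) (F 2) (F 3))
  | O_refl => inr m_eps
  | O_J => inr (m_J (R 2) (F 3) (R 4) (F 5))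
  | O_Pi => inl (m_Pi (R 0) (R 1) (R 2))
  | O_app => inr (m_app (R 0) (R 1) (F 3))
  | O_lam => inr (m_lam (R 0) (R 1) (F 3))
  | O_SET => inl (m_unit m_emp)
  | O_El => inl (m_unit (m_unit m_emp))
  | O_func_to_hom => inr m_eps
  end.

(** No type is neutral, so closure of neutral contexts under extension holds vacuously. *)
Definition m_isort (s : dsort) (l : seq value) (u : value) : Prop :=
  let R := fun i => vrel (nth (inl m_emp) l i) in
  match s, u with
  | S_Con, inl Γ => is_con Γ
  | S_Sub, inr σ => is_sub (R 0) (R 1) σ
  | S_Ty, inl A => is_ty (R 0) A
  | S_Tm, inr t => is_tm (R 0) (R 1) t
  | S_NCon, inr n => R 0 = m_emp /\ n = m_eps
  | _, _ => False
  end.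

(** Takes the telescope apart entry by entry, discards values of the wrong kind, and replaces each
    neutral context by [m_emp]. *)
Ltac unpack ρ i :=
  lazymatch goal with
  | |- _ /\ _ -> _ =>
      let x := fresh "x" in let H := fresh "H" in
      case; case: (ρ i) => x /= H; try (by case: H);
      lazymatch type of H with _ = m_emp /\ _ => case: H => ? ?; subst | _ => idtac end;
      unpack ρ (S i)
  | |- _ => move=> _
  end.

(** * Validity of the operations and axioms in the model *)

Lemma e_emp A : is_ty (m_op m_emp) A ->
  m_ty m_emp A (m_id m_emp) = A /\ m_op (m_tneg (m_op m_emp) A) = A.
Proof. by rewrite emp_op => tA; rewrite (ty_id emp_con tA) tneg_emp. Qed.

Lemma neg_tm A t : is_ty m_emp A -> is_tm m_emp (m_tneg m_emp A) t <-> is_tm m_emp A t.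
Proof.
move=> tA; split=> -[nt mt]; split=> // x y [-> ->]; have := mt _ _ (conj erefl erefl).
  by case.
by move=> H; apply/(tneg_vertical emp_con tA).
Qed.

Lemma refl_tm A t : is_tm m_emp (m_tneg m_emp A) t -> is_tm m_emp (m_hom m_emp A t t) m_eps.
Proof.
move=> tt; split=> // x y [-> ->].
by have [_ ? _ _] := tm_mono tt (conj erefl erefl); split; rewrite ?prE.
Qed.

Lemma unit_tm Γ t : is_tm Γ (m_unit Γ) t -> t = m_eps.
Proof.
case=> nt mt; apply: (normal_ext nt) => // x /mt [].
by rewrite !prE.
Qed.

Lemma unit_hom_tm t t' : is_tm m_emp (m_tneg m_emp (m_unit m_emp)) t ->
  is_tm m_emp (m_unit m_emp) t' -> is_tm m_emp (m_hom m_emp (m_unit m_emp) t t') m_eps.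
Proof.
move=> tt tt'; suff -> : t' = t by apply: refl_tm.
rewrite (unit_tm tt'); apply/esym/(unit_tm (Γ := m_emp)).
by move/(neg_tm _ (unit_ty emp_con)): tt.
Qed.

Lemma m_valid_op o : @valid_op DCwF_SET value m_iop m_isort o.
Proof.
case: o => ρ; rewrite /= /eval_sort /=.
all: unpack ρ 0.
- exact: id_sub.
- exact: comp_sub H2 H3.
- exact: emp_con.
- exact: ty_ty H1 H2.
- exact: tm_tm H2 H3.
- exact: pair_sub H2 H3.
- exact: p_sub.
- exact: v_tm H0.
- exact: op_con.
- exact: op_sub.
- exact: tneg_ty.
- by [].
- by rewrite emp_op.
- by rewrite emp_op; exact: id_sub.
- exact/neg_tm.
- by have [-> ->] := e_emp H0; exact/id_sub/ty_con/H0.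
- by have [-> ->] := e_emp H0; exact/id_sub/ty_con/H0.
- exact: hom_ty_ty.
- exact: refl_tm H1.
- exact: J_tm.
- exact: Pi_ty.
- exact: app_tm H2.
- exact: lam_tm H2.
- exact: unit_ty emp_con.
- exact: unit_ty (ty_con (unit_ty emp_con)).
- exact: unit_hom_tm H H0.
Qed.

Lemma eext_p A : is_ty (m_op m_emp) A ->
  m_comp (m_ty m_emp A (m_id m_emp)) (m_p (m_tneg (m_op m_emp) A)) (m_id A)
  = m_p (m_ty m_emp A (m_id m_emp)).
Proof.
rewrite emp_op => tA; rewrite (ty_id emp_con tA); apply: eq_restr => z zz /=.
by rewrite /m_id restrE // /m_p restrE //; apply/(tneg_vertical emp_con tA).
Qed.

Lemma eext_pair A t : is_tm (m_op m_emp) (m_tneg (m_op m_emp) A) t ->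
  m_pair (m_op m_emp) (m_id m_emp) t
  = m_comp m_emp (m_id A) (m_pair m_emp (m_id m_emp) (m_comp m_emp t (m_id m_emp))).
Proof.
rewrite emp_op => tt; rewrite (comp_idr (tm_normal tt)); apply: eq_restr => x [-> _] /=.
have [_ aa _ _] := tm_mono tt (conj erefl erefl).
by rewrite /m_pair /m_id !restrE.
Qed.

Lemma hom_tm_eps Γ A t t' h : is_tm Γ (m_hom Γ A t t') h -> h = m_eps.
Proof.
case=> nh mh; apply: (normal_ext nh) => // x /mh [].
by rewrite !prE.
Qed.

Lemma SET_neg_tm t : is_tm m_emp (m_tneg m_emp (m_unit m_emp)) t -> t = m_eps.
Proof. by move/(neg_tm _ (unit_ty emp_con))/unit_tm. Qed.

(** All values in [B] are [0], so the two functions agree pointwise, and canonicity of [f] turns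
    this into equality of codes. *)
Lemma lam_uniq A B b f : is_ty (m_op m_emp) A -> is_tm m_emp (m_Pi m_emp A B) f ->
  (forall z, B z z -> pr2 z = 0) -> (forall a, fib A 0 a -> b (pr 0 a) = 0) ->
  m_lam m_emp A b = f.
Proof.
move=> tA tf B0 b0; apply: restr_id (tm_normal tf) _ => x [-> _].
have [_ [+ _] sf _ _] := tm_mono tf (conj erefl erefl).
rewrite /m_canon !prE => ->; apply: eq_code => [|a aa]; first exact: ty_fin tA _.
have faa : m_extN m_emp A (pr 0 a) (pr 0 a) by apply/(extN_fib emp_con tA).
by have := sf a a; rewrite !prE b0 // => /(_ faa) /B0; rewrite prE.
Qed.

Lemma id_funE A a : is_ty (m_op m_emp) A -> fib A 0 a ->
  m_comp (m_extN m_emp A) (m_v (m_ty m_emp A (m_id m_emp))) (m_id A) (pr 0 a) = a.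
Proof.
move=> tA aa; have faa := (extN_fib emp_con tA 0 a).2 aa.
have [-> _] := e_emp tA.
by rewrite /m_comp restrE //= /m_id restrE // /m_v restrE // prE.
Qed.

Lemma m_valid_ax a : @valid_ax DCwF_SET value m_iop m_isort a.
Proof.
case: a => ρ; rewrite /= /eval_sort /=.
all: unpack ρ 0.
all: try by [].
all: congr (_ _).
- exact: comp_idl.
- exact: comp_idr (sub_normal H1).
- exact: comp_assoc.
- exact: eps_uniq H0.
- exact: ty_id.
- exact: ty_comp.
- exact: comp_idr (tm_normal H1).
- by rewrite (comp_assoc _ _ H H5).
- exact: pair_p H3 (sub_normal H2).
- exact: pair_v H3.
- exact: pair_comp.
- exact: pair_eta.
- exact: tneg_invol.
- exact: tneg_sub.
- exact: comp_idr (restr_normal _).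
- by rewrite emp_op; exact: comp_idr (restr_normal _).
- by have [-> _] := e_emp H0; exact: comp_idr (restr_normal _).
- by have [_ ->] := e_emp H0; exact: comp_idr (restr_normal _).
- exact: eext_p.
- exact: eext_pair.
- exact: hom_sub_eq.
- by apply/restr_id.
- exact: J_beta (tm_normal H3).
- rewrite (sub_emp_id H5); exact: J_sub (tm_normal H4).
- exact: Pi_sub.
- exact: app_sub.
- exact: Pi_beta H2.
- exact: Pi_eta H2.
- by rewrite (hom_tm_eps H1).
(* Directed univalence: both endpoints are the unique point of [SET], so J is evaluated at its base
   point and β leaves the identity function. It equals [f] because [El] has one-point fibres. *)
- have ? := SET_neg_tm H; have ? := unit_tm H0; subst.
  rewrite (J_beta _ (unit_ty emp_con) H); last exact: restr_normal.
  have cU : is_con (m_unit m_emp) := ty_con (unit_ty emp_con).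
  have tU := unit_ty cU.
  have sU : is_sub m_emp (m_unit m_emp) (m_pair m_emp (m_id m_emp) m_eps).
    apply: pair_sub (id_sub emp_con) _; rewrite ?(ty_id _ (unit_ty emp_con)) //.
      exact: emp_con.
    exact: emp_con.
  have tA := ty_ty (op_con emp_con) (ty_ty emp_con tU sU) (eps_sub (m_op m_emp)).
  apply: (lam_uniq tA H1) => [z [_ [_ []]]|a aa]; first by rewrite !prE.
  rewrite (id_funE tA) //.
  by case: aa => _ [_ []]; rewrite !prE.
Qed.

(** * The counterexample *)

Definition m_two : nrel := fun z w =>
  m_emp (pr1 z) (pr1 w) /\ pr2 z <= pr2 w <= 1.

Lemma two_ty : is_ty m_emp m_two.
Proof.
split.
- split=> [z w [[z0 w0] /andP[zw w1]]|x y z [[x0 _] /andP[xy _]] [[_ z0] /andP[yz z1]]].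
    by split; split=> //; rewrite leqnn //= (leq_trans zw).
  by split=> //; rewrite (leq_trans xy yz).
- by move=> z w [].
- move=> z γ zz [z0 ->]; exists (pr2 z).
  have -> : pr 0 (pr2 z) = z by rewrite -[RHS]pr_eta z0.
  by split.
- move=> γ; exists [:: 0; 1] => a [_]; rewrite !prE !inE.
  by case: a => [|[|a]] //; rewrite andbF.
Qed.

Lemma two_tm i : i <= 1 -> is_tm m_emp m_two (restr m_emp (fun=> i)).
Proof.
move=> i1; apply: restr_tm emp_con _ => x y [-> ->].
by split; rewrite !prE ?leqnn.
Qed.

Theorem proposition7 :
  ~ @definable DCwF_SET
      (∀ Γ ∈ Con, ∀ n ∈ NCon Γ, ∀ A ∈ Ty Γ,
       ∀ t ∈ Tm Γ (tneg Γ A), ∀ t' ∈ Tm Γ A,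
       ∀ h ∈ Tm Γ (hom Γ A t t'),
       ⊢ Tm Γ (hom Γ A (neg Γ n A t') (neg Γ n (tneg Γ A) t))).
Proof.
case=> s D.
pose zero := restr m_emp (fun=> 0); pose one := restr m_emp (fun=> 1).
(* The generic arguments in order: empty context, neutrality witness, [A] the two-element chain, [t]
   = 0, [t'] = 1, and the witness of 0 ≤ 1. *)
pose ρ := nth (inl m_emp)
  [:: inl m_emp; inr m_eps; inl m_two; inr zero; inr one; inr m_eps : value].
have zero_tm := two_tm (leq0n 1); have one_tm := two_tm (leqnn 1).
have zero_neg : is_tm m_emp (m_tneg m_emp m_two) zero by apply/(neg_tm _ two_ty).
have h_tm : is_tm m_emp (m_hom m_emp m_two zero one) m_eps.
  by split=> // x y [-> ->]; split; rewrite ?prE // /zero /one !restrE //.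
have := soundness (ρ := ρ) m_valid_op m_valid_ax D; rewrite /= /eval_sort /=.
move=> /(_ (conj emp_con (conj (conj erefl erefl)
  (conj two_ty (conj zero_neg (conj one_tm (conj h_tm I))))))).
(* Whatever the defining expression evaluates to, it would inhabit the hom-type from 1 to 0 and so
   prove 1 ≤ 0. *)
case: (eval _ _ s) => // f /tm_mono /(_ 0 0 (conj erefl erefl)) [_ _ _ [_]].
by rewrite /zero /one !restrE // !prE.
Qed.
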